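(* Let $\mathcal{Q}=(Q_1,\dots,Q_{n+1})$ be a sequence where each $Q_i$ is a closed $K_i$-orbit in $\mathcal{B}_i$, and let $X_{\mathcal{Q}}=\{\mathfrak{b}\in\mathcal{B}_{n+1}:\ \pi_i(\mathfrak{b})\in Q_i \text{ for } 1\le i\le n+1\}$. Then $X_{\mathcal{Q}}$ consists of a single Borel subalgebra of $\mathfrak{g}=\mathfrak{gl}(n+1,\mathbb{C})$, and this Borel subalgebra contains the Cartan subalgebra of diagonal matrices. Moreover, every Borel subalgebra of $\mathfrak{g}$ containing the diagonal matrices equals the unique element of $X_{\mathcal{Q}}$ for some such sequence $\mathcal{Q}$ of closed $K_i$-orbits.
   Context: $n\ge1$. For $1\le i\le n+1$, $\mathfrak{g}_i\cong\mathfrak{gl}(i,\mathbb{C})$ is the subalgebra of $\mathfrak{g}$ of matrices supported in the upper left $i\times i$ corner, and $\pi_i:\mathfrak{g}\to\mathfrak{g}_i$ keeps the entries in the upper left $i\times i$ corner and sets the others to $0$. $\mathcal{B}_i$ is the flag variety (variety of Borel subalgebras) of $\mathfrak{g}_i$. $K_i=GL(i-1,\mathbb{C})\times GL(1,\mathbb{C})\subset GL(i,\mathbb{C})$ is the group of invertible block diagonal matrices with blocks of sizes $i-1$ and $1$ (the fixed group of conjugation by $\mathrm{diag}(1,\dots,1,-1)$), acting on $\mathcal{B}_i$ by conjugation with finitely many orbits; ''closed'' means Zariski closed in $\mathcal{B}_i$. The condition $\pi_i(\mathfrak{b})\in Q_i$ means that $\pi_i(\mathfrak{b})$ is a Borel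 subalgebra of $\mathfrak{g}_i$ belonging to $Q_i$. *)

(* Defs.v *)
From HB Require Import structures.
From mathcomp Require Import all_boot all_order all_algebra.
From mathcomp Require Import mpoly.
Set Implicit Arguments. Unset Strict Implicit. Unset Printing Implicit Defensive.
Import GRing.Theory Num.Theory.
Local Open Scope ring_scope.

Section Defs.
Variable C : numClosedFieldType.

(* Linear subspaces of gl(i) = 'M_i are represented by row spaces of square
   matrices 'M_(i*i), an element A of gl(i) being encoded by mxvec A. *)
Definition in_sp (i : nat) (A : 'M[C]_i) (V : 'M[C]_(i * i)) : Prop :=
  (mxvec A <= V)%MS.

Definition lie_br (i : nat) (A B : 'M[C]_i) : 'M[C]_i := A *m B - B *m A.

Definition lie_sub (i : nat) (V : 'M[C]_(i * i)) : Prop :=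
  forall A B : 'M[C]_i, in_sp A V -> in_sp B V -> in_sp (lie_br A B) V.

Definition derived (i : nat) (V : 'M[C]_(i * i)) : 'M[C]_(i * i) :=
  (\sum_(r < i * i) \sum_(s < i * i)
     <<mxvec (lie_br (vec_mx (row r V)) (vec_mx (row s V)))>>)%MS.

Definition solvable_sp (i : nat) (V : 'M[C]_(i * i)) : Prop :=
  exists k : nat, (iter k (@derived i) V <= (0 : 'M[C]_(i * i)))%MS.

Definition Borel (i : nat) (V : 'M[C]_(i * i)) : Prop :=
  [/\ lie_sub V, solvable_sp V &
      forall W : 'M[C]_(i * i), lie_sub W -> solvable_sp W ->
        (V <= W)%MS -> (W <= V)%MS].

(* K_i = GL(i-1) x GL(1), block diagonal invertible matrices *)
Definition inK (i : nat) (k : 'M[C]_i) : Prop :=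
  k \in unitmx /\
  forall a b : 'I_i, ((a : nat) == i.-1) != ((b : nat) == i.-1) -> k a b = 0.

Definition conj_sp (i : nat) (k : 'M[C]_i) (V : 'M[C]_(i * i)) : 'M[C]_(i * i) :=
  <<V *m lin1_mx (fun v : 'rV[C]_(i * i) => mxvec (k *m vec_mx v *m invmx k))>>%MS.

Definition K_orbit (i : nat) (b0 : 'M[C]_(i * i)) (V : 'M[C]_(i * i)) : Prop :=
  exists k, inK k /\ (V == conj_sp k b0)%MS.

(* Zariski topology on the Grassmannian Gr(d, N): a set Z of subspaces is
   closed iff its preimage in the set of full-rank d x N basis matrices
   is the zero set (within that open set) of a family of polynomials. *)
Definition zclosed_d (d N : nat) (Z : 'M[C]_N -> Prop) : Prop :=
  exists P : {mpoly C[d * N]} -> Prop,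
    forall M : 'M[C]_(d, N), row_free M ->
      ((exists V, Z V /\ (M == V)%MS) <->
       (forall p, P p -> p.@[fun k => mxvec M 0 k] = 0)).

Definition zclosed_gr (N : nat) (Z : 'M[C]_N -> Prop) : Prop :=
  forall d, zclosed_d d Z.

Definition closed_in_B (i : nat) (S : 'M[C]_(i * i) -> Prop) : Prop :=
  exists Z, zclosed_gr Z /\ forall V, S V <-> (Borel V /\ Z V).

Definition closed_K_orbit (i : nat) (S : 'M[C]_(i * i) -> Prop) : Prop :=
  (exists b0, Borel b0 /\ forall V, S V <-> K_orbit b0 V) /\ closed_in_B S.

Definition corner (n i : nat) (A : 'M[C]_n.+1) : 'M[C]_i :=
  \matrix_(j < i, k < i) A (inord j) (inord k).

Definition proj_sp (n i : nat) (V : 'M[C]_(n.+1 * n.+1)) : 'M[C]_(i * i) :=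
  <<V *m lin1_mx (fun v : 'rV[C]_(n.+1 * n.+1) => mxvec (corner i (vec_mx v)))>>%MS.

Definition XQ (n : nat) (Q : forall i : nat, 'M[C]_(i * i) -> Prop)
  (b : 'M[C]_(n.+1 * n.+1)) : Prop :=
  Borel b /\
  forall i : nat, (1 <= i <= n.+1)%N -> Borel (proj_sp i b) /\ Q i (proj_sp i b).

Definition contains_diag (m : nat) (b : 'M[C]_(m * m)) : Prop :=
  forall A : 'M[C]_m, is_diag_mx A -> in_sp A b.

End Defs.

(* Main.v *)
Require Import Defs.
From HB Require Import structures.
From mathcomp Require Import all_boot all_order all_algebra.
From mathcomp Require Import fingroup perm mpoly zify ring.
Set Implicit Arguments. Unset Strict Implicit. Unset Printing Implicit Defensive.
Import Order.TTheory GRing.Theory Num.Theory.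
Local Open Scope ring_scope.

(** By Lie's theorem the Borel subalgebras of gl(m) are the stabilizers of full
    flags.  The group [diag(1, .., 1, t)] is central in [K_m]; degenerating a
    flag along it lands in a flag compatible with C^(m-1) + C e_m, so a closed
    [K_m]-orbit consists of such split flags and is determined by the position
    [j] of the line C e_m.  The position is cut out among all Borel subalgebras
    by bounds on the ranks of the last row and the last column, so these orbits
    are indeed closed.
    If every corner projection of [b] lies in a split orbit, the projections
    contain the matrices E_kk, and grading by them shows E_kk in [b].  Hence [b]
    is given by a total order of the basis vectors, and the positions of [k]
    among [1..k] for all [k] amount exactly to such an order. *)

(** Matrices act on row vectors from the right, so the flag attached to [g] is spanned by its
    leading rows. The obstacle is the topology: closedness means polynomial equations in the entries
    of basis matrices. To use it one needs a polynomial curve of such bases that stays of full rank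
    at the limit. The torus has no value at its limit point, so the same degeneration is written as
    conjugation by [1 + s N] with [N *m N = 0], which is quadratic in [s] and invertible throughout.
    To prove closedness, two numbers are attached to a flag: the step [q] where it leaves the
    hyperplane of rows with last entry zero, and the step [p] where it first contains the last basis
    vector. Always [q <= p], and the flag is split exactly when they agree. The rank of the last
    columns is governed by [q], that of the last rows by [p], so two upper bounds on ranks, hence
    minors, squeeze both numbers to [j]. *)

Section Subspaces.
Variable C : numClosedFieldType.

(** * Spaces of matrices as row spaces *)

Lemma lin1_mxE (m n : nat) (f : 'rV[C]_m -> 'rV[C]_n) :
  linear f -> forall u, u *m lin1_mx f = f u.
Proof.
move=> fL u; pose F : {linear 'rV[C]_m -> 'rV[C]_n} :=
  HB.pack f (GRing.isLinear.Build _ _ _ _ f fL).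
exact: (mul_rV_lin1 F).
Qed.

Lemma in_sp_subP (i : nat) (V W : 'M[C]_(i * i)) :
  (forall A, in_sp A V -> in_sp A W) -> (V <= W)%MS.
Proof.
move=> VW; apply/rV_subP => v vV.
by rewrite -(vec_mxK v); apply: VW; rewrite /in_sp vec_mxK.
Qed.

Lemma in_spS (i : nat) (V W : 'M[C]_(i * i)) (A : 'M[C]_i) :
  (V <= W)%MS -> in_sp A V -> in_sp A W.
Proof. by move=> VW AV; exact: submx_trans VW. Qed.

Lemma in_sp_eqmx (i : nat) (V W : 'M[C]_(i * i)) (A : 'M[C]_i) :
  (V == W)%MS -> in_sp A V <-> in_sp A W.
Proof. by move=> /andP[VW WV]; split; apply: in_spS. Qed.

Lemma in_sp_eqP (i : nat) (V W : 'M[C]_(i * i)) :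
  (forall A, in_sp A V <-> in_sp A W) -> (V == W)%MS.
Proof. by move=> VW; apply/andP; split; apply: in_sp_subP => A /VW. Qed.

Lemma in_sp_row (i : nat) (V : 'M[C]_(i * i)) r : in_sp (vec_mx (row r V)) V.
Proof. by rewrite /in_sp vec_mxK row_sub. Qed.

Lemma in_spD (i : nat) (V : 'M[C]_(i * i)) A B :
  in_sp A V -> in_sp B V -> in_sp (A + B) V.
Proof. by move=> AV BV; rewrite /in_sp linearD addmx_sub. Qed.

Lemma in_spZ (i : nat) (V : 'M[C]_(i * i)) a A :
  in_sp A V -> in_sp (a *: A) V.
Proof. by move=> AV; rewrite /in_sp linearZ scalemx_sub. Qed.

Lemma in_spB (i : nat) (V : 'M[C]_(i * i)) A B :
  in_sp A V -> in_sp B V -> in_sp (A - B) V.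
Proof. by move=> AV BV; rewrite -scaleN1r; apply/in_spD/in_spZ. Qed.

Lemma in_sp_sum (i : nat) (V : 'M[C]_(i * i)) (I : finType) (F : I -> 'M[C]_i) :
  (forall k, in_sp (F k) V) -> in_sp (\sum_k F k) V.
Proof.
move=> FV; apply: (big_ind (fun A => in_sp A V)) => //.
  by rewrite /in_sp linear0 sub0mx.
exact: in_spD.
Qed.

Lemma in_sp_rows (i : nat) (V : 'M[C]_(i * i)) A :
  in_sp A V -> exists c : 'I_(i * i) -> C, A = \sum_r c r *: vec_mx (row r V).
Proof.
move=> /submxP[u uE]; exists (u 0).
rewrite -(mxvecK A) uE mulmx_sum_row linear_sum /=.
by apply: eq_bigr => r _; rewrite linearZ.
Qed.

(** Both [conj_sp] and [proj_sp] are images of this shape, so this one description of membership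
    serves conjugation and projection alike. *)
Lemma in_sp_mul_lin1 (i k : nat) (V : 'M[C]_(i * i)) (f : 'M[C]_i -> 'M[C]_k)
  (B : 'M[C]_k) : linear f ->
  in_sp B <<V *m lin1_mx (fun v => mxvec (f (vec_mx v)))>>%MS <->
  exists2 A, in_sp A V & B = f A.
Proof.
move=> fL; have gL : linear (fun v : 'rV[C]_(i * i) => mxvec (f (vec_mx v))).
  by move=> a u v; rewrite linearP fL linearP.
rewrite /in_sp genmxE; split=> [/submxP[u]|[A /submxP[u uE] ->]]; last first.
  by apply/submxP; exists u; rewrite mulmxA -uE (lin1_mxE gL) mxvecK.
rewrite mulmxA (lin1_mxE gL) => /(can_inj mxvecK) ->.
by exists (vec_mx (u *m V)) => //; rewrite vec_mxK submxMl.
Qed.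

(** [derived] is generated by brackets of the rows of [V] only; bilinearity extends this to
    arbitrary elements. *)
Lemma in_sp_derived (i : nat) (V : 'M[C]_(i * i)) A B :
  in_sp A V -> in_sp B V -> in_sp (lie_br A B) (derived V).
Proof.
move=> /in_sp_rows[a ->] /in_sp_rows[b ->].
have lieL (D : 'M[C]_i) (F : 'I_(i * i) -> 'M[C]_i) :
    lie_br (\sum_r a r *: F r) D = \sum_r a r *: lie_br (F r) D.
  rewrite /lie_br mulmx_suml mulmx_sumr -sumrB; apply: eq_bigr => r _.
  by rewrite scalerBr -scalemxAl -scalemxAr.
have lieR (D : 'M[C]_i) (F : 'I_(i * i) -> 'M[C]_i) :
    lie_br D (\sum_r b r *: F r) = \sum_r b r *: lie_br D (F r).
  rewrite /lie_br mulmx_suml mulmx_sumr -sumrB; apply: eq_bigr => r _.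
  by rewrite scalerBr -scalemxAl -scalemxAr.
rewrite lieL; apply: in_sp_sum => r; apply: in_spZ.
rewrite lieR; apply: in_sp_sum => s; apply: in_spZ.
rewrite /in_sp /derived (sumsmx_sup r) // (sumsmx_sup s) //.
by rewrite genmxE.
Qed.

Lemma derived_subP (i : nat) (V W : 'M[C]_(i * i)) :
  (forall A B, in_sp A V -> in_sp B V -> in_sp (lie_br A B) W) ->
  (derived V <= W)%MS.
Proof.
move=> VW; apply/sumsmx_subP => r _; apply/sumsmx_subP => s _.
by rewrite genmxE; apply: VW; apply: in_sp_row.
Qed.

Lemma lie_sub_derived (i : nat) (V : 'M[C]_(i * i)) :
  lie_sub V -> (derived V <= V)%MS /\ lie_sub (derived V).
Proof.
move=> Vlie; have DV : (derived V <= V)%MS by exact: derived_subP.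
by split=> // A B AV BV; apply: in_sp_derived; apply: in_spS DV _.
Qed.

End Subspaces.

(** * Lie's theorem in characteristic zero *)

Section LieTheorem.
Variable C : numClosedFieldType.

(* Along the Krylov rows [w x^p] every [h] in [H] is triangular with constant
   diagonal its weight, so the weight of the commutator [x h - h x] vanishes
   because its trace does (characteristic 0).  All Krylov rows then have the
   same weight as [w], and an eigenvector of [x] among their combinations
   is the new common eigenvector. *)
Lemma weight_step (m : nat) (w : 'rV[C]_m) (x : 'M[C]_m) (H : 'M[C]_m -> Prop) :
    w != 0 -> (forall h, H h -> H (lie_br x h)) ->
    (forall h, H h -> (w *m h <= w)%MS) ->
  exists2 w' : 'rV[C]_m, w' != 0 &
    (w' *m x <= w')%MS /\ forall h, H h -> (w' *m h <= w')%MS.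
Proof.
move=> w0 Hx Hw.
pose v p := iter p (fun u => u *m x) w.
pose W p := \matrix_(q < p) v q.
have vW p q : (q < p)%N -> (v q <= W p)%MS.
  by move=> lt_qp; have := row_sub (Ordinal lt_qp) (W p); rewrite rowK.
have WS p q : (p <= q)%N -> (W p <= W q)%MS.
  move=> le_pq; apply/row_subP => r; rewrite rowK.
  by apply: vW; apply: leq_trans le_pq.
have Wx p : (W p *m x <= W p.+1)%MS.
  by apply/row_subP => r; rewrite row_mul rowK -[v r *m x]/(v r.+1) vW ?ltnS.
have rankW p : (forall q, (q < p)%N -> ~~ (v q <= W q)%MS) -> (p <= \rank (W p))%N.
  elim: p => // p IHp Hp; apply: leq_ltn_trans (IHp _) _.
    by move=> q lt_qp; apply: Hp; apply: ltnW.
  have : (W p < W p.+1)%MS.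
    rewrite ltmxE WS //=; apply: contra (Hp p (ltnSn p)).
    by apply: submx_trans; apply: vW.
  by rewrite ltmxErank => /andP[].
have exk : exists k, (v k <= W k)%MS.
  have [/existsP[q qP]|] := boolP [exists q : 'I_m.+1, (v q <= W q)%MS].
    by exists q.
  rewrite negb_exists => /forallP Hp.
  have := rankW m.+1 (fun q lt_qm => Hp (Ordinal lt_qm)).
  by rewrite leqNgt ltnS rank_leq_col.
have [k vk kmin] := ex_minnP exk.
have freeB : row_free (W k).
  rewrite /row_free eqn_leq rank_leq_row rankW // => q lt_qk.
  by apply: contraL lt_qk => /kmin; rewrite -leqNgt.
have k0 : (0 < k)%N.
  case: k {freeB kmin} vk => // /submxP[u].
  by rewrite [W 0]flatmx0 mulmx0 => /eqP; rewrite (negPf w0).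
set B := W k in freeB vk.
have BX : (B *m x <= B)%MS.
  apply: submx_trans (Wx k) _; apply/row_subP => r; rewrite rowK.
  by have := ltn_ord r; rewrite ltnS leq_eqVlt => /predU1P[->//|/vW].
pose X := B *m x *m pinvmx B.
have XB : X *m B = B *m x by rewrite mulmxKpV.
clearbody X.
(* The weight is quantified after [p] because the induction calls the claim both for [h] and for
   [lie_br x h], whose weight [b] contributes only a multiple of the earlier row [v p]. *)
have low p : forall h a, H h -> w *m h = a *: w ->
    (v p *m h - a *: v p <= W p)%MS.
  elim: p => [|p IHp] h a Hh wh; first by rewrite wh subrr sub0mx.
  have [b wb] : exists b, w *m lie_br x h = b *: w by apply/sub_rVP/Hw/Hx.
  have -> : v p.+1 *m h - a *: v p.+1 =
      (v p *m h - a *: v p) *m x + ((v p *m lie_br x h - b *: v p) + b *: v p).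
    rewrite subrK /= /lie_br mulmxBl mulmxBr -!scalemxAl !mulmxA.
    by rewrite [RHS]addrC addrA subrK.
  apply: addmx_sub; first by apply: submx_trans (Wx p); apply: submxMr; exact: IHp.
  apply: addmx_sub; last by apply/scalemx_sub/vW.
  by apply: submx_trans (WS _ _ (leqnSn p)); apply: IHp => //; apply: Hx.
have lowB h a : H h -> w *m h = a *: w ->
    exists2 T : 'M_k, T *m B = B *m h & forall p, T p p = a.
  move=> Hh wh; have Bh : (B *m h <= B)%MS.
    apply/row_subP => p; rewrite row_mul rowK -(subrK (a *: v p) (_ *m h)).
    apply: addmx_sub; last by apply/scalemx_sub/vW.
    by apply: submx_trans (low p h a Hh wh) _; apply: WS; apply: ltnW.
  exists (B *m h *m pinvmx B) => [|p]; first by rewrite mulmxKpV.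
  have : (B *m h *m pinvmx B) *m B = B *m h by rewrite mulmxKpV.
  move: (B *m h *m pinvmx B) => T TB.
  have /submxP[u uE] := low p h a Hh wh.
  have lt_pk : (p <= k)%N by apply: ltnW.
  have : row p T - a *: delta_mx 0 p = \sum_q u 0 q *: delta_mx 0 (widen_ord lt_pk q).
    apply: (row_free_inj freeB); rewrite mulmxBl -row_mul TB row_mul rowK.
    rewrite -scalemxAl -rowE rowK uE mulmx_sum_row mulmx_suml.
    by apply: eq_bigr => q _; rewrite -scalemxAl -rowE !rowK.
  move/rowP/(_ p); rewrite !mxE !eqxx mulr1 summxE big1 => [/eqP|q _].
    by rewrite subr_eq0 => /eqP.
  by rewrite !mxE eqxx -val_eqE /= gtn_eqF ?ltn_ord // mulr0.
have w_lie h : H h -> w *m lie_br x h = 0.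
  move=> Hh; have [a wh] : exists a, w *m h = a *: w by apply/sub_rVP/Hw.
  have [b wb] : exists b, w *m lie_br x h = b *: w by apply/sub_rVP/Hw/Hx.
  have [T TB _] := lowB h a Hh wh.
  have [S SB Sd] := lowB _ b (Hx h Hh) wb.
  have : S = X *m T - T *m X.
    apply: (row_free_inj freeB); rewrite SB mulmxBl -!mulmxA TB XB !mulmxA XB TB.
    by rewrite /lie_br mulmxBr !mulmxA.
  move/(congr1 mxtrace); rewrite raddfB /= mxtrace_mulC subrr.
  rewrite /mxtrace (eq_bigr (fun=> b)) // sumr_const card_ord => /eqP.
  by rewrite mulrn_eq0 eqn0Ngt k0 /= wb => /eqP->; rewrite scale0r.
have vh p : forall h a, H h -> w *m h = a *: w -> v p *m h = a *: v p.
  elim: p => // p IHp h a Hh wh.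
  have -> : v p.+1 *m h = v p *m h *m x + v p *m lie_br x h.
    by rewrite /lie_br mulmxBr !mulmxA addrC subrK.
  rewrite (IHp h a) // (IHp (lie_br x h) 0) ?scale0r ?addr0 -?scalemxAl //.
    exact: Hx.
  exact: w_lie.
have [a /eigenvalueP[u uX u0]] := eigenvalue_closed X k0.
exists (u *m B); first by rewrite mulmx_free_eq0.
split.
  by rewrite -mulmxA -XB mulmxA uX -scalemxAl scalemx_sub.
move=> h Hh; have [b wh] : exists b, w *m h = b *: w by apply/sub_rVP/Hw.
suff -> : u *m B *m h = b *: (u *m B) by apply: scalemx_sub.
rewrite -mulmxA scalemxAr; congr (u *m _).
by apply/row_matrixP => p; rewrite row_mul linearZ /= rowK; apply: vh.
Qed.

(** Triangularization passes to quotient actions, so it is stated for representations. Brackets are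
    preserved only on [V], since outside [V] the quotient block need not be multiplicative. *)
Definition lie_rep (N m : nat) (V : 'M[C]_(N * N)) (rho : 'M[C]_N -> 'M[C]_m) :=
  linear rho /\ forall A B, in_sp A V -> in_sp B V ->
    rho (lie_br A B) = lie_br (rho A) (rho B).

Lemma lie_common_eigenvector (N m k : nat) (V : 'M[C]_(N * N))
    (rho : 'M[C]_N -> 'M[C]_m) :
    (0 < m)%N -> lie_sub V -> (iter k (@derived C N) V <= (0 : 'M_(N * N)))%MS ->
    lie_rep V rho ->
  exists2 w : 'rV[C]_m, w != 0 & forall A, in_sp A V -> (w *m rho A <= w)%MS.
Proof.
move=> m0 Vlie Vk [rhoL rhoV].
pose R : {linear 'M[C]_N -> 'M[C]_m} :=
  HB.pack rho (GRing.isLinear.Build _ _ _ _ rho rhoL).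
have rhoE A : rho A = R A by [].
elim: k V Vlie Vk rhoV => [|k IHk] V Vlie Vk rhoV.
  exists (delta_mx 0 (Ordinal m0)).
    by apply/eqP => /rowP/(_ (Ordinal m0)); rewrite !mxE !eqxx; apply/eqP/oner_neq0.
  move=> A /submx_trans/(_ Vk); rewrite submx0 mxvec_eq0 => /eqP->.
  by rewrite rhoE linear0 mulmx0 sub0mx.
have [DV Dlie] := lie_sub_derived Vlie.
have [|A B AD BD|w w0 wD] := IHk (derived V) Dlie; first by rewrite -iterSr.
  by apply: rhoV; apply: in_spS DV _.
(* The rows of [V] are adjoined one at a time. The bracket of a row with anything already treated
   falls into [derived V], which gives the stability required by [weight_step]. *)
have addrows (s : seq 'M[C]_N) : (forall A, A \in s -> in_sp A V) ->
    exists2 w : 'rV[C]_m, w != 0 &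
      forall A, in_sp A (derived V) \/ A \in s -> (w *m rho A <= w)%MS.
  elim: s => [|x s IHs] sV; first by exists w => // A [/wD|].
  have xV : in_sp x V by apply: sV; rewrite mem_head.
  have {}sV A : A \in s -> in_sp A V by move=> As; apply: sV; rewrite inE As orbT.
  have [u u0 us] := IHs sV.
  have [|Y [A [As ->]]|Y [A [As ->]]|u' u'0 [u'x u's]] := @weight_step _ u (rho x)
    (fun Y => exists A, (in_sp A (derived V) \/ A \in s) /\ Y = rho A).
  - by [].
  - have AV : in_sp A V by case: As => [/(in_spS DV)|/sV].
    exists (lie_br x A); split; last by rewrite rhoV.
    by left; apply: in_sp_derived.
  - exact: us.
  exists u' => // A []; first by move=> AD; apply: u's; exists A; split; [left|].
  rewrite inE => /predU1P[->//|As]; apply: u's; exists A; split=> //.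
  by right.
have [|u u0 us] := addrows [seq vec_mx (row r V) | r <- enum 'I_(N * N)].
  by move=> A /mapP[r _ ->]; apply: in_sp_row.
exists u => // A /in_sp_rows[c ->].
rewrite rhoE linear_sum mulmx_sumr; apply: summx_sub => r _.
rewrite linearZ -scalemxAr scalemx_sub //; apply: us; right.
by apply: map_f; rewrite mem_enum.
Qed.

(** Induction on the dimension: with a common eigenvector as first basis row, the upper right block
    vanishes, and the lower right block is the representation on the quotient. *)
Lemma lie_trigonalization (N : nat) (V : 'M[C]_(N * N)) :
    lie_sub V -> solvable_sp V ->
  forall (m : nat) (rho : 'M[C]_N -> 'M[C]_m), lie_rep V rho ->
  exists g g' : 'M[C]_m, g *m g' = 1%:M /\
    forall A, in_sp A V -> is_trig_mx (g *m rho A *m g').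
Proof.
move=> Vlie [k Vk]; elim=> [|m IHm] rho rhoV.
  exists 1%:M, 1%:M; split; first by rewrite mulmx1.
  by move=> A _; apply/is_trig_mxP => -[].
have [w w0 wV] := lie_common_eigenvector (ltn0Sn m) Vlie Vk rhoV.
have [rhoL rhoB] := rhoV.
(* [row_ebase w] completes [w] to a basis: it is invertible and [w] is a nonzero multiple of its
   first row. *)
pose g1 : 'M[C]_(1 + m) := row_ebase w.
pose h1 : 'M[C]_(1 + m) := invmx g1.
have gh1 : g1 *m h1 = 1%:M by rewrite mulmxV ?row_ebase_unit.
have hg1 : h1 *m g1 = 1%:M by rewrite mulVmx ?row_ebase_unit.
have w_g1 : exists2 a, a != 0 & w = a *: row 0 g1.
  have := mulmx_ebase w; rewrite rank_rV w0 => wE; exists (col_ebase w 0 0).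
    have := col_ebase_unit w; rewrite unitmxE det_mx11 unitfE.
    by [].
  rewrite -{1}wE [col_ebase w]mx11_scalar !mul_scalar_mx mxE eqxx mulr1n.
  rewrite -scalemxAl; congr (_ *: _); rewrite rowE; congr (_ *m _).
  by apply/rowP => j; rewrite !mxE !eqxx /= -val_eqE /= andbT eq_sym.
pose f A : 'M[C]_(1 + m) := g1 *m rho A *m h1.
have ur0 A : in_sp A V -> ursubmx (f A) = 0.
  move=> /wV; have [a a0 ->] := w_g1.
  rewrite -scalemxAl => /sub_rVP[b]; rewrite scalerA mulrC -scalerA.
  move/(scalerI a0) => rE; apply/matrixP => i j; rewrite ord1 !mxE.
  have -> : lshift m (0 : 'I_1) = 0 :> 'I_m.+1 by apply/ord_inj.
  have := congr1 (fun M => (M *m h1) 0 (rshift 1 j)) rE.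
  rewrite -row_mul -scalemxAl -!row_mul gh1 !mxE => ->.
  by rewrite mulr0.
pose rho' A := drsubmx (f A).
have [|g [g' [gg' gV]]] := IHm rho'.
  split=> [a A B|A B AV BV].
    rewrite /rho' /f rhoL mulmxDr mulmxDl -scalemxAr -scalemxAl.
    move: (g1 *m rho A *m h1) (g1 *m rho B *m h1) => X Y.
    by apply/matrixP => i j; rewrite !mxE.
  have fM X Y : f X *m f Y = g1 *m (rho X *m rho Y) *m h1.
    by rewrite /f -!mulmxA (mulmxA h1) hg1 mul1mx.
  have drM X Y : in_sp Y V ->
      drsubmx (f X *m f Y) = drsubmx (f X) *m drsubmx (f Y).
    move=> YV; rewrite -{1}[f X]submxK -{1}[f Y]submxK mulmx_block block_mxKdr.
    by rewrite (ur0 Y) // mulmx0 add0r.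
  have drB X Y : drsubmx X - drsubmx Y = drsubmx (X - Y : 'M[C]_(1 + m)).
    by apply/matrixP => i j; rewrite !mxE.
  rewrite [RHS]/lie_br /rho' -!drM // !fM drB -mulmxBl -mulmxBr.
  by rewrite /f rhoB.
pose G : 'M[C]_(1 + m) := block_mx 1%:M 0 0 g.
pose G' : 'M[C]_(1 + m) := block_mx 1%:M 0 0 g'.
have GG' : G *m G' = 1%:M.
  rewrite /G /G' mulmx_block !mul0mx !mulmx0 !mul1mx !addr0 ?add0r gg'.
  by rewrite -scalar_mx_block.
exists (G *m g1), (h1 *m G'); split.
  by rewrite mulmxA -(mulmxA G) gh1 mulmx1.
move=> A AV; have -> : G *m g1 *m rho A *m (h1 *m G') = G *m f A *m G'.
  by rewrite /f !mulmxA.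
suff: @is_trig_mx _ (1 + m) (1 + m) (G *m f A *m G') by [].
rewrite -[f A]submxK ur0 // /G /G' !mulmx_block.
do 3!rewrite ?mul0mx ?mulmx0 ?mul1mx ?mulmx1 ?addr0 ?add0r.
by rewrite is_trig_block_mx // eqxx mx11_is_trig; apply: gV.
Qed.

End LieTheorem.

(** * Borel subalgebras as stabilizers of full flags *)

Section TriangularSubalgebras.
Variable C : numClosedFieldType.

Definition low_part (m k : nat) (X : 'M[C]_m) : 'M[C]_m :=
  \matrix_(a, b) if (a < b + k)%N then X a b else 0.

(** A filtration by distance below the diagonal in the basis [g]: level 0 is lower triangular, level
    1 strictly lower triangular. The kernel turns these vanishing conditions into a row space. *)
Definition low_sp (m k : nat) (g : 'M[C]_m) : 'M[C]_(m * m) :=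
  kermx (lin1_mx (fun v => mxvec (low_part k (g *m vec_mx v *m invmx g)))).

(** For invertible [g], the stabilizer of the flag spanned by the leading rows of [g]. *)
Definition trig_sp (m : nat) (g : 'M[C]_m) := low_sp 0 g.

Lemma in_low_sp (m k : nat) (g A : 'M[C]_m) :
  in_sp A (low_sp k g) <->
  forall a b : 'I_m, (a < b + k)%N -> (g *m A *m invmx g) a b = 0.
Proof.
have fL : linear (fun v => mxvec (low_part k (g *m vec_mx v *m invmx g))).
  move=> c u v; rewrite linearP mulmxDr mulmxDl -scalemxAr -scalemxAl.
  rewrite -[RHS](linearP mxvec); congr mxvec.
  apply/matrixP => a b; rewrite !mxE.
  by case: ifP; rewrite ?mulr0 ?addr0 ?mxE.
rewrite /in_sp; split=> [/sub_kermxP|A0].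
  rewrite (lin1_mxE fL) mxvecK => /eqP; rewrite mxvec_eq0 => /eqP/matrixP A0 a b ltab.
  by have := A0 a b; rewrite [LHS]mxE ltab [RHS]mxE.
apply/sub_kermxP; rewrite (lin1_mxE fL) mxvecK; apply/eqP; rewrite mxvec_eq0.
apply/eqP/matrixP => a b; rewrite [LHS]mxE [RHS]mxE.
by case: ifP => // /A0.
Qed.

Lemma in_trig_sp (m : nat) (g A : 'M[C]_m) :
  in_sp A (trig_sp g) <-> is_trig_mx (g *m A *m invmx g).
Proof.
apply: iff_trans (in_low_sp 0 g A) _; split.
  by move=> H; apply/is_trig_mxP => a b ltab; apply: H; rewrite addn0.
by move/is_trig_mxP => H a b; rewrite addn0; apply: H.
Qed.

Lemma mulmx_is_trig (m : nat) (X Y : 'M[C]_m) :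
  is_trig_mx X -> is_trig_mx Y -> is_trig_mx (X *m Y).
Proof.
move=> /is_trig_mxP X0 /is_trig_mxP Y0; apply/is_trig_mxP => a b ltab.
rewrite mxE big1 // => c _; have [/X0->|le_ca] := ltnP a c; first by rewrite mul0r.
by rewrite (Y0 c b) ?mulr0 // (leq_ltn_trans le_ca).
Qed.

Lemma conj_mulmx (m : nat) (g A B : 'M[C]_m) : g \in unitmx ->
  g *m (A *m B) *m invmx g = (g *m A *m invmx g) *m (g *m B *m invmx g).
Proof. by move=> gU; rewrite !mulmxA mulmxKV. Qed.

Lemma conj_lie_br (m : nat) (g A B : 'M[C]_m) : g \in unitmx ->
  g *m lie_br A B *m invmx g =
  lie_br (g *m A *m invmx g) (g *m B *m invmx g).
Proof. by move=> gU; rewrite /lie_br mulmxBr mulmxBl !conj_mulmx. Qed.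

(** A nonzero term of either product at [(a, b)] forces [a >= b + 2 k], which [a <= b + k] allows
    only when [a = b]; on the diagonal the two products have equal entries and cancel. *)
Lemma lie_br_low (m k : nat) (X Y : 'M[C]_m) :
    (forall a b : 'I_m, (a < b + k)%N -> X a b = 0) ->
    (forall a b : 'I_m, (a < b + k)%N -> Y a b = 0) ->
  forall a b : 'I_m, (a < b + k.+1)%N -> lie_br X Y a b = 0.
Proof.
move=> X0 Y0 a b ltab.
have [a_eq_b|a_neq_b] := eqVneq a b.
  rewrite {}a_eq_b /lie_br !mxE -sumrB big1 // => c _.
  have [ltbc|ltcb|/val_inj->] := ltngtP b c; last by rewrite mulrC subrr.
    by rewrite (X0 b c) ?(Y0 b c) ?mulr0 ?mul0r ?subrr // ltn_addr.
  by rewrite (X0 c b) ?(Y0 c b) ?mulr0 ?mul0r ?subrr // ltn_addr.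
have prod0 (P Q : 'M[C]_m) : (forall a b : 'I_m, (a < b + k)%N -> P a b = 0) ->
    (forall a b : 'I_m, (a < b + k)%N -> Q a b = 0) -> (P *m Q) a b = 0.
  move=> P0 Q0; rewrite mxE big1 // => c _.
  have [/P0->|le_ca] := ltnP a (c + k); first by rewrite mul0r.
  have [/Q0->|le_bc] := ltnP c (b + k); first by rewrite mulr0.
  by case/eqP: a_neq_b; apply: val_inj => /=; lia.
by rewrite /lie_br mxE [X in _ + X]mxE !prod0 // subr0.
Qed.

Lemma lie_sub_trig_sp (m : nat) (g : 'M[C]_m) :
  g \in unitmx -> lie_sub (trig_sp g).
Proof.
move=> gU A B /in_low_sp A0 /in_low_sp B0; apply/in_low_sp => a b ltab.
by rewrite conj_lie_br // (lie_br_low A0 B0) // addn1 ltnS ltnW // -(addn0 b).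
Qed.

Lemma solvable_sub_trig_sp (m : nat) (g : 'M[C]_m) (V : 'M[C]_(m * m)) :
  g \in unitmx -> (V <= trig_sp g)%MS -> solvable_sp V.
Proof.
move=> gU VT; exists m.
have Vk k : (iter k (@derived C m) V <= low_sp k g)%MS.
  elim: k => // k IHk; rewrite iterS; apply: derived_subP => A B AV BV.
  have /in_low_sp A0 := in_spS IHk AV; have /in_low_sp B0 := in_spS IHk BV.
  by apply/in_low_sp => a b ltab; rewrite conj_lie_br // (lie_br_low A0 B0).
apply: submx_trans (Vk m) _; apply: in_sp_subP => A /in_low_sp A0.
suff -> : A = 0 by rewrite /in_sp linear0 sub0mx.
rewrite -(mulKmx gU A) -(mulmxKV gU (g *m A)).
suff -> : g *m A *m invmx g = 0 by rewrite mul0mx mulmx0.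
by apply/matrixP => a b; rewrite A0 ?mxE // ltn_addl.
Qed.

Lemma in_conj_sp (m : nat) (k : 'M[C]_m) (V : 'M[C]_(m * m)) A :
  k \in unitmx -> in_sp A (conj_sp k V) <-> in_sp (invmx k *m A *m k) V.
Proof.
move=> kU; have fL : linear (fun B => k *m B *m invmx k).
  by move=> c X Y; rewrite mulmxDr mulmxDl -scalemxAr -scalemxAl.
apply: iff_trans (in_sp_mul_lin1 V A fL) _.
split=> [[B BV ->]|AV]; first by rewrite !mulmxA mulVmx // mul1mx mulmxKV.
by exists (invmx k *m A *m k); rewrite ?mulmxA ?mulmxV ?mul1mx ?mulmxK.
Qed.

Lemma invmxM (m : nat) (g h : 'M[C]_m) : g \in unitmx -> h \in unitmx ->
  invmx (g *m h) = invmx h *m invmx g.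
Proof.
move=> gU hU; apply: (can_inj (mulKmx (_ : g *m h \in unitmx))).
  by rewrite unitmx_mul gU.
by rewrite mulmxV ?unitmx_mul ?gU // mulmxA mulmxK // mulmxV.
Qed.

Lemma conj_trig_sp (m : nat) (k g : 'M[C]_m) : k \in unitmx -> g \in unitmx ->
  (conj_sp k (trig_sp g) == trig_sp (g *m invmx k))%MS.
Proof.
move=> kU gU; apply: in_sp_eqP => A; apply: iff_trans (in_conj_sp _ _ kU) _.
apply: iff_trans (in_trig_sp _ _) (iff_trans _ (iff_sym (in_trig_sp _ _))).
by rewrite invmxM ?unitmx_inv // invmxK !mulmxA.
Qed.

Lemma conj_sp_eqmx (m : nat) (k : 'M[C]_m) (V W : 'M[C]_(m * m)) :
  k \in unitmx -> (V == W)%MS -> (conj_sp k V == conj_sp k W)%MS.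
Proof.
move=> kU VW; apply: in_sp_eqP => A.
apply: iff_trans (in_conj_sp _ _ kU) (iff_trans _ (iff_sym (in_conj_sp _ _ kU))).
exact: in_sp_eqmx.
Qed.

(** Any two flag stabilizers are conjugate, so exchanging [g] and [h] gives equal dimensions; nested
    stabilizers therefore coincide. *)
Lemma rank_trig_sp (m : nat) (g h : 'M[C]_m) : g \in unitmx -> h \in unitmx ->
  (\rank (trig_sp h) <= \rank (trig_sp g))%N.
Proof.
move=> gU hU; pose k := invmx h *m g.
have kU : k \in unitmx by rewrite unitmx_mul unitmx_inv hU.
have := conj_trig_sp kU gU; rewrite /k invmxM ?unitmx_inv // invmxK mulmxA.
rewrite mulmxV // mul1mx => /eqmxP <-.
by rewrite /conj_sp mxrank_gen mxrankM_maxl.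
Qed.

(** Lie's theorem puts every solvable subalgebra inside a flag stabilizer. Maximality then gives one
    direction, and equality of dimensions of nested stabilizers the other. *)
Lemma BorelP (m : nat) (V : 'M[C]_(m * m)) :
  Borel V <-> exists2 g, g \in unitmx & (V == trig_sp g)%MS.
Proof.
have lie_trig (W : 'M[C]_(m * m)) : lie_sub W -> solvable_sp W ->
    exists2 g, g \in unitmx & (W <= trig_sp g)%MS.
  move=> Wlie Wsol; have [|g [g' [gg' gW]]] :=
    lie_trigonalization Wlie Wsol (rho := fun A => A); first by split.
  have [gU _] := mulmx1_unit gg'.
  exists g => //; apply: in_sp_subP => A /gW AW; apply/in_trig_sp.
  by rewrite -(mulmx1 (invmx g)) -gg' mulKmx.
split=> [[Vlie Vsol Vmax]|[g gU VT]].
  have [g gU VT] := lie_trig V Vlie Vsol; exists g => //; rewrite VT /=.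
  apply: Vmax => //; first exact: lie_sub_trig_sp.
  exact: solvable_sub_trig_sp gU (submx_refl _).
have VTE A := in_sp_eqmx A VT; case/andP: (VT) => VT1 VT2; split.
- by move=> A B /VTE AT /VTE BT; apply/VTE; apply: lie_sub_trig_sp.
- exact: solvable_sub_trig_sp VT1.
move=> W Wlie Wsol VW; have [h hU WT] := lie_trig W Wlie Wsol.
have gh : (trig_sp g <= trig_sp h)%MS.
  exact: submx_trans VT2 (submx_trans VW WT).
have : (trig_sp g == trig_sp h)%MS.
  by rewrite -(geq_leqif (mxrank_leqif_eq gh)); exact: rank_trig_sp.
case/andP => _ hg; exact: submx_trans WT (submx_trans hg VT2).
Qed.

Lemma Borel_trig_sp (m : nat) (g : 'M[C]_m) : g \in unitmx -> Borel (trig_sp g).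
Proof. by move=> gU; apply/BorelP; exists g; rewrite ?submx_refl. Qed.

Lemma eqsp_trans (a b c n : nat) (U : 'M[C]_(a, n)) (V : 'M[C]_(b, n))
  (W : 'M[C]_(c, n)) :
  (U == V)%MS -> (V == W)%MS -> (U == W)%MS.
Proof.
move=> /andP[UV VU] /andP[VW WV]; apply/andP; split.
  exact: submx_trans UV VW.
exact: submx_trans WV VU.
Qed.

Lemma eqsp_sym (a b n : nat) (U : 'M[C]_(a, n)) (V : 'M[C]_(b, n)) :
  (U == V)%MS -> (V == U)%MS.
Proof. by case/andP=> UV VU; apply/andP. Qed.

Lemma Borel_eqmx (m : nat) (V W : 'M[C]_(m * m)) :
  (V == W)%MS -> Borel V -> Borel W.
Proof.
move=> VW /BorelP[g gU VT]; apply/BorelP; exists g => //.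
exact: eqsp_trans (eqsp_sym VW) VT.
Qed.

(** Lower triangular row operations change the basis but not the flag. The inverse [T'] is an
    argument because each use exhibits it explicitly, with its triangularity. *)
Lemma trig_sp_mulT (m : nat) (T T' g : 'M[C]_m) : g \in unitmx ->
  T *m T' = 1%:M -> is_trig_mx T -> is_trig_mx T' ->
  T *m g \in unitmx /\ (trig_sp (T *m g) == trig_sp g)%MS.
Proof.
move=> gU TT' Ttrig T'trig; have [TU _] := mulmx1_unit TT'.
have TgU : T *m g \in unitmx by rewrite unitmx_mul TU.
have T'E : invmx T = T' by rewrite -(mulmx1 (invmx T)) -TT' mulKmx.
split=> //; apply: in_sp_eqP => A.
apply: iff_trans (in_trig_sp _ _) (iff_trans _ (iff_sym (in_trig_sp _ _))).
rewrite invmxM // T'E; have T'T : T' *m T = 1%:M by rewrite -T'E mulVmx.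
have -> : T *m g *m A *m (invmx g *m T') = T *m (g *m A *m invmx g) *m T'.
  by rewrite !mulmxA.
move: (g *m A *m invmx g) => X.
split=> Xtrig; last by rewrite !mulmx_is_trig.
have -> : X = T' *m (T *m X *m T') *m T.
  by rewrite !mulmxA T'T mul1mx -mulmxA T'T mulmx1.
by apply: mulmx_is_trig => //; apply: mulmx_is_trig.
Qed.

End TriangularSubalgebras.

(** * Split flags and their orbits under block diagonal matrices *)

Section Orbits.
Variables (C : numClosedFieldType) (m : nat).
Implicit Types (g k : 'M[C]_m.+1) (V : 'M[C]_(m.+1 * m.+1)) (j q : 'I_m.+1).

Local Notation er j := (delta_mx (0 : 'I_1) j : 'rV[C]_m.+1).
Local Notation ec j := (delta_mx j (0 : 'I_1) : 'cV[C]_m.+1).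

(** The row equation puts the last basis vector at place [j] of the flag; the column equation puts
    all other rows of [g] in the complementary hyperplane. *)
Definition frame j g :=
  [/\ g \in unitmx, er j *m g = er ord_max & g *m ec ord_max = ec j].

(* Up to K these are the stabilizers of the coordinate flags in which the last
   basis vector comes at position [j]. *)
Definition split_orbit j V :=
  exists2 g, frame j g & (V == trig_sp g)%MS.

Lemma er_ec j : er j *m ec j = 1%:M.
Proof. by rewrite mul_delta_mx; apply/matrixP => a b; rewrite !ord1 !mxE. Qed.

Lemma is_trig_add (X Y : 'M[C]_m.+1) :
  is_trig_mx X -> is_trig_mx Y -> is_trig_mx (X + Y).
Proof.
move=> /is_trig_mxP X0 /is_trig_mxP Y0; apply/is_trig_mxP => a b ltab.
by rewrite mxE X0 // Y0 // addr0.
Qed.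

Lemma is_trig_scale c (X : 'M[C]_m.+1) : is_trig_mx X -> is_trig_mx (c *: X).
Proof.
move=> /is_trig_mxP X0; apply/is_trig_mxP => a b ltab.
by rewrite mxE X0 // mulr0.
Qed.

Lemma is_trig_delta j q : (q <= j)%N -> is_trig_mx (ec j *m er q).
Proof.
move=> le_qj; apply/is_trig_mxP => a b ltab; rewrite mul_delta_mx mxE.
case: eqP => [aj|] //=; case: eqP => [bq|] //=.
by move: ltab; rewrite aj bq ltnNge le_qj.
Qed.

(** Block diagonality in coordinate-free form: the last basis vector is an eigenvector on both
    sides, with one nonzero eigenvalue. *)
Lemma inKP k : inK k <-> k \in unitmx /\ exists c,
  [/\ c != 0, k *m ec ord_max = c *: ec ord_max & er ord_max *m k = c *: er ord_max].
Proof.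
split=> [[kU k0]|[kU [c [c0 kc kr]]]]; split=> //.
  have kc : k *m ec ord_max = k ord_max ord_max *: ec ord_max.
    apply/colP => a; rewrite -colE !mxE eqxx andbT.
    have [->|neq] := eqVneq a ord_max; first by rewrite mulr1.
    rewrite mulr0 k0 //= eqxx; move: neq; rewrite -val_eqE /=.
    by move/negPf->.
  exists (k ord_max ord_max); split=> //.
    apply/eqP => c0; have := congr1 (mulmx (invmx k)) kc.
    rewrite c0 scale0r mulmx0 mulKmx // => /matrixP/(_ ord_max 0)/eqP.
    by rewrite !mxE !eqxx oner_eq0.
  apply/rowP => a; rewrite -rowE !mxE eqxx /=.
  have [->|neq] := eqVneq a ord_max; first by rewrite mulr1.
  rewrite mulr0 k0 //= eqxx; move: neq; rewrite -val_eqE /=.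
  by move/negPf->.
move=> a b /= ab.
have kac : k a ord_max = c * (a == ord_max)%:R.
  by move/colP/(_ a): kc; rewrite -colE !mxE eqxx andbT.
have krb : k ord_max b = c * (b == ord_max)%:R.
  by move/rowP/(_ b): kr; rewrite -rowE !mxE eqxx /=.
have [am|am] := eqVneq (a : nat) m; have [bm|bm] := eqVneq (b : nat) m.
- by move: ab; rewrite am bm !eqxx.
- have -> : a = ord_max by apply: val_inj.
  by rewrite krb -val_eqE /= (negPf bm) mulr0.
- have -> : b = ord_max by apply: val_inj.
  by rewrite kac -val_eqE /= (negPf am) mulr0.
- by move: ab; rewrite (negPf am) (negPf bm).
Qed.

Lemma inKV k : inK k -> inK (invmx k).
Proof.
move=> /inKP[kU [c [c0 kc kr]]]; apply/inKP; split; first by rewrite unitmx_inv.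
exists c^-1; split; first by rewrite invr_eq0.
  apply: (can_inj (mulKmx kU)); rewrite mulKVmx // -scalemxAr kc scalerA mulVf //.
  by rewrite scale1r.
apply: (can_inj (mulmxK kU)); rewrite /= mulmxKV // -scalemxAl kr scalerA mulVf //.
by rewrite scale1r.
Qed.

Lemma inKM k h : inK k -> inK h -> inK (k *m h).
Proof.
move=> /inKP[kU [c [c0 kc kr]]] /inKP[hU [d [d0 hc hr]]]; apply/inKP.
split; first by rewrite unitmx_mul kU.
exists (c * d); split; first by rewrite mulf_neq0.
  by rewrite -mulmxA hc -scalemxAr kc scalerA mulrC.
by rewrite mulmxA kr -scalemxAl hr scalerA.
Qed.

Lemma inK_unit k : inK k -> k \in unitmx. Proof. by case. Qed.

Lemma K_orbit_trans (U V W : 'M[C]_(m.+1 * m.+1)) :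
  K_orbit U V -> K_orbit V W -> K_orbit U W.
Proof.
move=> [k [kK VU]] [h [hK WV]]; exists (h *m k); split; first exact: inKM.
have [kU hU] := (inK_unit kK, inK_unit hK).
apply: eqsp_trans WV (eqsp_trans (conj_sp_eqmx hU VU) _).
apply: in_sp_eqP => A; apply: iff_trans (in_conj_sp _ _ hU) _.
apply: iff_trans (in_conj_sp _ _ kU) (iff_trans _ (iff_sym (in_conj_sp _ _ _))).
  by rewrite invmxM // !mulmxA.
by rewrite unitmx_mul hU.
Qed.

Lemma K_orbit_sym (U V : 'M[C]_(m.+1 * m.+1)) : K_orbit U V -> K_orbit V U.
Proof.
move=> [k [kK VU]]; exists (invmx k); split; first exact: inKV.
have kU := inK_unit kK; have kU' : invmx k \in unitmx by rewrite unitmx_inv.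
apply: eqsp_trans (eqsp_sym (conj_sp_eqmx kU' VU)).
apply: in_sp_eqP => A; apply: iff_sym; apply: iff_trans (in_conj_sp _ _ kU') _.
apply: iff_trans (in_conj_sp _ _ kU) _.
by rewrite invmxK !mulmxA mulVmx // mul1mx mulmxKV.
Qed.

Lemma K_orbit_eqmx (U V : 'M[C]_(m.+1 * m.+1)) : (U == V)%MS -> K_orbit U V.
Proof.
move=> UV; exists 1%:M; split.
  apply/inKP; split; first exact: unitmx1.
  by exists 1; rewrite oner_neq0 !scale1r mul1mx mulmx1.
apply: in_sp_eqP => A; apply: iff_trans (iff_sym (in_conj_sp _ _ (unitmx1 _ _))).
by rewrite invmx1 mul1mx mulmx1; apply: in_sp_eqmx; apply: eqsp_sym.
Qed.

Lemma split_orbitE j g V : frame j g -> split_orbit j V <-> K_orbit (trig_sp g) V.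
Proof.
move=> [gU gr gc]; split=> [[h [hU hr hc] VT]|[k [kK VT]]].
  exists (invmx h *m g); have kU : invmx h *m g \in unitmx.
    by rewrite unitmx_mul unitmx_inv hU.
  split.
    apply/inKP; split=> //; exists 1; rewrite oner_neq0 !scale1r; split=> //.
      by rewrite -mulmxA gc -hc mulKmx.
    by rewrite mulmxA -hr mulmxK // gr hr.
  apply: eqsp_trans VT (eqsp_sym (eqsp_trans (conj_trig_sp kU gU) _)).
  by rewrite invmxM ?unitmx_inv // invmxK mulmxA mulmxV // mul1mx !submx_refl.
have /inKP[_ [c [c0 kc kr]]] := inKV kK.
have kU := inK_unit kK.
have gkU : g *m invmx k \in unitmx by rewrite unitmx_mul gU unitmx_inv.
(* Translating a frame by [k] multiplies its distinguished row and column by [c]; a scalar matrix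
   restores the normalization and keeps the flag. *)
have [] := @trig_sp_mulT _ _ (c^-1)%:M c%:M _ gkU.
- by rewrite -scalar_mxM mulVf.
- exact: scalar_mx_is_trig.
- exact: scalar_mx_is_trig.
move=> hU hT; exists (c^-1%:M *m (g *m invmx k)).
  split=> //.
    by rewrite mul_scalar_mx -scalemxAr mulmxA gr kr scalerA mulVf // scale1r.
  rewrite mul_scalar_mx -scalemxAl -mulmxA kc -scalemxAr gc scalerA mulVf //.
  by rewrite scale1r.
by apply: eqsp_trans VT (eqsp_trans (conj_trig_sp kU gU) _); apply: eqsp_sym.
Qed.

(** Here [q] is the first row of [g] with nonzero last entry, the step where the flag leaves the
    hyperplane. Row [q] can clear the later entries of the last column by lower triangular
    operations. *)
Lemma normalize_last_col g : g \in unitmx ->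
  exists q h, [/\ h \in unitmx, (trig_sp h == trig_sp g)%MS &
                  h *m ec ord_max = ec q].
Proof.
move=> gU; have [y yE] : exists y, y = g *m ec ord_max by eexists.
have /cV0Pn[q0 yq0] : y != 0.
  apply/eqP => y0; have := congr1 (mulmx (invmx g)) y0.
  rewrite yE mulKmx // mulmx0 => /matrixP/(_ ord_max 0)/eqP.
  by rewrite !mxE !eqxx oner_eq0.
pose q := [arg min_(a < q0 | y a 0 != 0) (a : nat)].
have [yq ymin] : y q 0 != 0 /\ forall a, y a 0 != 0 -> (q <= a)%N.
  by rewrite /q; case: arg_minnP.
have ylow (a : 'I_m.+1) : (a < q)%N -> y a 0 = 0.
  by move=> lt_aq; apply/eqP; apply: contraTT lt_aq => /ymin; rewrite -leqNgt.
(* [1 + (y q)^-1 u (er q)] carries [y] to [ec q]. Its inverse is [1 - u (er q)] because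
   [er q *m u = 1 - y q]. *)
pose u := ec q - y; pose ue := u *m er q.
have ue_trig : is_trig_mx ue.
  apply/is_trig_mxP => a b ltab; rewrite /ue mxE big_ord1 /u !mxE eqxx andbT /=.
  have [bq|] := eqVneq b q; last by rewrite mulr0.
  by rewrite bq in ltab; rewrite ylow // -val_eqE (ltn_eqF ltab) subrr mul0r.
have eu : er q *m u = (1 - y q 0)%:M.
  by rewrite mulmxBr er_ec -rowE [row _ _]mx11_scalar mxE -raddfB.
have uue : ue *m ue = (1 - y q 0) *: ue.
  by rewrite /ue mulmxA -(mulmxA u) eu mul_mx_scalar -scalemxAl.
have ey : er q *m y = (y q 0)%:M by rewrite -rowE [row _ _]mx11_scalar mxE.
have [] := @trig_sp_mulT _ _ (1%:M + (y q 0)^-1 *: ue) (1%:M - ue) _ gU.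
- rewrite mulmxDl mul1mx -scalemxAl.
  have -> : ue *m (1%:M - ue) = y q 0 *: ue.
    by rewrite mulmxBr mulmx1 uue scalerBl scale1r opprB addrC subrK.
  by rewrite scalerA mulVf // scale1r subrK.
- by rewrite is_trig_add ?is_trig_scale ?scalar_mx_is_trig.
- by rewrite -scaleN1r is_trig_add ?is_trig_scale ?scalar_mx_is_trig.
move=> hU hT; exists q, ((1%:M + (y q 0)^-1 *: ue) *m g); split=> //.
rewrite -mulmxA -yE mulmxDl mul1mx -scalemxAl /ue -mulmxA ey mul_mx_scalar.
by rewrite scalerA mulVf // scale1r addrC subrK.
Qed.

(** The vanishing hypothesis says that the last basis vector is a combination of rows [0..q] of [g].
    Comparing last entries, its coefficient on row [q] is 1, so it can replace that row without
    changing the flag. *)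
Lemma normalize_last_row q g : g \in unitmx -> g *m ec ord_max = ec q ->
    (forall c : 'I_m.+1, (q < c)%N -> (er ord_max *m invmx g) 0 c = 0) ->
  split_orbit q (trig_sp g).
Proof.
move=> gU gc x0; pose x := er ord_max *m invmx g.
have xe : x *m ec q = 1%:M by rewrite -gc /x mulmxA mulmxKV // er_ec.
pose w := x - er q; pose N := ec q *m w.
have we : w *m ec q = 0 by rewrite mulmxBl xe er_ec subrr.
have NN : N *m N = 0 by rewrite /N mulmxA -(mulmxA _ w) we mulmx0 mul0mx.
have Ntrig : is_trig_mx N.
  apply/is_trig_mxP => a b ltab; rewrite mxE big_ord1.
  have [aq|neq] := eqVneq a q; last by rewrite [ec q _ _]mxE (negPf neq) mul0r.
  rewrite aq in ltab; have bq : (b == q) = false by rewrite -val_eqE gtn_eqF.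
  by rewrite /w [X in _ * X]mxE x0 // !mxE bq andbF subrr mulr0.
have [] := @trig_sp_mulT _ _ (1%:M + N) (1%:M - N) _ gU.
- by rewrite mulmxDl mul1mx mulmxBr mulmx1 NN subr0 subrK.
- by rewrite is_trig_add ?scalar_mx_is_trig.
- by rewrite -scaleN1r is_trig_add ?is_trig_scale ?scalar_mx_is_trig.
move=> hU hT; exists ((1%:M + N) *m g); last exact: eqsp_sym.
split=> //.
  rewrite mulmxA mulmxDr mulmx1 /N mulmxA er_ec mul1mx addrC subrK.
  by rewrite /x mulmxKV.
by rewrite -mulmxA gc mulmxDl mul1mx /N -mulmxA we mulmx0 addr0.
Qed.

End Orbits.

(** * Closed orbits contain split flags *)

Section ClosedOrbits.
Variables (C : numClosedFieldType).

Lemma poly_eq0_off1 (P : {poly C}) : (forall s, s != 1 -> P.[s] = 0) -> P = 0.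
Proof.
move=> P0; apply/eqP; apply: contraT => Pn0.
(* The numbers 2, 3, ... avoid 1 and are distinct in characteristic zero; [size P] roots are one
   more than the degree allows. *)
pose rs := [seq (i.+2)%:R : C | i <- iota 0 (size P)].
have := @max_poly_roots _ P rs Pn0; rewrite size_map size_iota ltnn => -> //.
  apply/allP => _ /mapP[i _ ->]; apply/rootP/P0.
  by rewrite -[1]/(1%:R) eqr_nat.
rewrite map_inj_uniq ?iota_uniq // => i j /eqP.
by rewrite eqr_nat => /eqP[].
Qed.

Lemma meval_poly_path (n : nat) (p : {mpoly C[n]}) (Q : 'I_n -> {poly C}) s :
  p.@[fun k => (Q k).[s]] = (mmap polyC Q p).[s].
Proof.
rewrite /meval /mmap horner_sum; apply: eq_bigr => mm _.
rewrite hornerM hornerC /mmap1 horner_prod; congr (_ * _).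
by apply: eq_bigr => i _; rewrite horner_exp.
Qed.

(** The form in which closedness is used: an equation satisfied along a quadratic curve away from
    [s = 1] persists at [s = 1]. *)
Lemma meval_eq0_limit (n : nat) (p : {mpoly C[n]}) (a b c : 'I_n -> C) :
    (forall s, s != 1 -> p.@[fun k => a k + s * b k + s ^+ 2 * c k] = 0) ->
  p.@[fun k => a k + b k + c k] = 0.
Proof.
pose Q k := (a k)%:P + 'X * (b k)%:P + 'X^2 * (c k)%:P.
have QE s k : (Q k).[s] = a k + s * b k + s ^+ 2 * c k by rewrite !hornerE.
move=> p0; have := @meval_poly_path _ p Q 1.
rewrite (@poly_eq0_off1 (mmap polyC Q p)) ?horner0 => [<-|s s1].
  by apply: meval_eq => k; rewrite QE expr1n !mul1r.
by rewrite -meval_poly_path -[RHS](p0 s s1); apply: meval_eq => k; rewrite QE.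
Qed.

Variable m : nat.
Implicit Types (g k : 'M[C]_m.+1) (V : 'M[C]_(m.+1 * m.+1)) (j q : 'I_m.+1).

Local Notation er j := (delta_mx (0 : 'I_1) j : 'rV[C]_m.+1).
Local Notation ec j := (delta_mx j (0 : 'I_1) : 'cV[C]_m.+1).

(** Since [N *m N = 0], conjugating [A] by [1 + s N] gives [A + s [N, A] - s^2 N A N]. Applied to a
    basis this is a quadratic curve of full-rank matrices, also at the limit. *)
Lemma conj_unipotent_basis g (N : 'M[C]_m.+1) (d : nat) (B : 'M[C]_(d, m.+1 * m.+1)) :
    g \in unitmx -> N *m N = 0 -> row_free B -> (B == trig_sp g)%MS ->
  exists M0 M1 M2 : 'M[C]_(d, m.+1 * m.+1), forall s,
    let M := M0 + s *: M1 + s ^+ 2 *: M2 in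
    row_free M /\ (M == trig_sp (g *m (1%:M - s *: N)))%MS.
Proof.
move=> gU NN Bfree BT.
pose A i := vec_mx (row i B).
exists (\matrix_i mxvec (A i)), (\matrix_i mxvec (lie_br N (A i))),
  (\matrix_i mxvec (- (N *m A i *m N))) => s M.
pose k := 1%:M + s *: N; pose k' := 1%:M - s *: N.
have kk' : k *m k' = 1%:M.
  rewrite mulmxDl mul1mx mulmxBr mulmx1 -scalemxAl -scalemxAr NN !scaler0 subr0.
  by rewrite subrK.
have kU : k \in unitmx by case/mulmx1_unit: kk'.
have k'E : k' = invmx k by rewrite -(mulKmx kU k') kk' mulmx1.
have gkU : g *m k' \in unitmx by rewrite unitmx_mul gU k'E unitmx_inv.
have rowM i : row i M = mxvec (k *m A i *m k').
  have -> : k *m A i *m k' =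
      A i + s *: lie_br N (A i) + s ^+ 2 *: - (N *m A i *m N).
    rewrite /k /k' /lie_br mulmxDl mul1mx mulmxBr mulmx1 -scalemxAr mulmxDl.
    by rewrite -!scalemxAl scalerDr scalerA -expr2 scalerBr scalerN opprD !addrA.
  rewrite linearD [mxvec (_ + _)]linearD !linearZ /= /M.
  by rewrite 2!linearD 2!linearZ /= !rowK linearN.
have MT : (M == trig_sp (g *m k'))%MS.
  have e := conj_trig_sp kU gU; rewrite -k'E in e.
  apply: eqsp_trans e; apply/andP; split.
    apply/row_subP => i; rewrite rowM; apply/in_conj_sp => //.
    rewrite !mulmxA mulVmx // mul1mx -mulmxA k'E mulVmx // mulmx1.
    by rewrite /in_sp vec_mxK; apply: submx_trans (row_sub _ _) (andP BT).1.
  apply/rV_subP => v; rewrite -(vec_mxK v); move: (vec_mx v) => X /in_conj_sp XT.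
  have /submxP[u uE] := submx_trans (XT kU) (andP BT).2.
  have -> : X = k *m (invmx k *m X *m k) *m k'.
    by rewrite k'E !mulmxA mulmxV // mul1mx mulmxK.
  apply/submxP; exists u.
  rewrite -(mxvecK (invmx k *m X *m k)) uE mulmx_sum_row linear_sum /=.
  rewrite mulmx_sumr mulmx_suml linear_sum mulmx_sum_row; apply: eq_bigr => i _.
  by rewrite rowM linearZ -scalemxAr -scalemxAl linearZ.
split=> //; rewrite /row_free (eqmx_rank MT) -[X in _ == X](eqP Bfree) (eqmx_rank BT).
by rewrite eqn_leq !rank_trig_sp.
Qed.

(* [g (1 - s N)] equals [D_t g L_t] with [t = 1 - s], [D_t] scaling row [q]
   by [t] and [L_t] scaling the last column by [1/t]: for [t <> 0] this is a
   flag in the K-orbit of [g], and at [t = 0] it becomes split. *)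
Lemma split_degeneration g q : g \in unitmx -> g *m ec ord_max = ec q ->
  let N := ec ord_max *m (er q *m g - er ord_max) in
  [/\ N *m N = 0, frame q (g *m (1%:M - 1 *: N)) &
      forall s, s != 1 -> K_orbit (trig_sp g) (trig_sp (g *m (1%:M - s *: N)))].
Proof.
move=> gU gc N; pose x := er q *m g - er ord_max.
have xe : x *m ec ord_max = 0 by rewrite mulmxBl -mulmxA gc !er_ec subrr.
have NN : N *m N = 0 by rewrite /N -/x mulmxA -(mulmxA _ x) xe mulmx0 mul0mx.
split=> //.
  split.
  - rewrite unitmx_mul gU; have : (1%:M - 1 *: N) *m (1%:M + 1 *: N) = 1%:M.
      by rewrite !scale1r mulmxBl mul1mx mulmxDr mulmx1 NN addr0 addrK.
    by case/mulmx1_unit.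
  - rewrite scale1r mulmxA mulmxBr mulmx1 /N -/x mulmxA -(mulmxA _ g) gc er_ec.
    by rewrite mul1mx /x opprB addrC subrK.
  - by rewrite scale1r -mulmxA mulmxBl mul1mx /N -/x -mulmxA xe mulmx0 subr0.
move=> s s1; have t0 : 1 - s != 0 by rewrite subr_eq0 eq_sym.
(* Chosen so that [1 + r] is the inverse of [1 - s]; hence [L] inverts [k] and [D'] inverts [D]. *)
pose r := s / (1 - s).
have Einv j a b : a + b - a * b = 0 ->
    (1%:M - a *: (ec j *m er j)) *m (1%:M - b *: (ec j *m er j)) = 1%:M.
  move=> ab; set E := ec j *m er j.
  have EE : E *m E = E by rewrite /E mulmxA -(mulmxA _ (er j)) er_ec mulmx1.
  rewrite mulmxBl mul1mx -scalemxAl mulmxBr mulmx1 -scalemxAr EE scalerBr scalerA.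
  by rewrite -scalerBl -addrA -opprD -scalerDl addrCA addrA ab scale0r subr0.
have rE : s - r + s * r = 0 by rewrite /r; field.
pose k : 'M[C]_m.+1 := 1%:M - s *: (ec ord_max *m er ord_max).
pose L : 'M[C]_m.+1 := 1%:M - (- r) *: (ec ord_max *m er ord_max).
have kL : k *m L = 1%:M by apply: Einv; rewrite mulrN opprK.
have kU : k \in unitmx by case/mulmx1_unit: kL.
have LE : L = invmx k by rewrite -(mulKmx kU L) kL mulmx1.
pose D : 'M[C]_m.+1 := 1%:M - s *: (ec q *m er q).
pose D' : 'M[C]_m.+1 := 1%:M - (- r) *: (ec q *m er q).
have DD' : D *m D' = 1%:M by apply: Einv; rewrite mulrN opprK.
have gLU : g *m L \in unitmx by rewrite unitmx_mul gU LE unitmx_inv.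
have hE : g *m (1%:M - s *: N) = D *m (g *m L).
  have gL : g *m L = g + r *: (ec q *m er ord_max).
    by rewrite mulmxBr mulmx1 -scalemxAr mulmxA gc scaleNr opprK.
  have qgL : er q *m (g *m L) = er q *m g + r *: er ord_max.
    by rewrite gL mulmxDr -scalemxAr mulmxA er_ec mul1mx.
  rewrite [RHS]mulmxBl mul1mx -scalemxAl -mulmxA qgL gL [in RHS]mulmxDr -[in RHS]scalemxAr.
  rewrite scalerDr scalerA opprD addrACA -scalerBl.
  have -> : r - s * r = s by rewrite /r; field.
  by rewrite mulmxBr mulmx1 -scalemxAr mulmxA gc mulmxBr scalerBr opprD opprK addrA.
exists k; split.
  apply/inKP; split=> //; exists (1 - s); split=> //.
    by rewrite mulmxBl mul1mx -scalemxAl -mulmxA er_ec mulmx1 scalerBl scale1r.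
  by rewrite mulmxBr mulmx1 -scalemxAr mulmxA er_ec mul1mx scalerBl scale1r.
rewrite hE; apply: eqsp_trans (eqsp_sym (conj_trig_sp kU gU)); rewrite -LE.
have Etrig j a : is_trig_mx (1%:M - a *: (ec j *m er j)).
  by rewrite -scaleNr is_trig_add ?is_trig_scale ?is_trig_delta ?scalar_mx_is_trig.
by have [] := trig_sp_mulT gLU DD' (Etrig _ _) (Etrig _ _).
Qed.

Lemma closed_K_orbit_split (S : 'M[C]_(m.+1 * m.+1) -> Prop) :
  closed_K_orbit S -> exists j, forall V, S V <-> split_orbit j V.
Proof.
move=> [[b0 [/BorelP[g0 g0U b0T] Sb0]] [Z [Zcl SZ]]].
have [q [g [gU gT gc]]] := normalize_last_col g0U; exists q.
have b0g : (b0 == trig_sp g)%MS := eqsp_trans b0T (eqsp_sym gT).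
have [NN gfr gK] := split_degeneration gU gc.
set N := ec ord_max *m _ in NN gfr gK.
pose B := row_base (trig_sp g).
have BT : (B == trig_sp g)%MS by apply/eqmxP/eq_row_base.
have [M0 [M1 [M2 Ms]]] := conj_unipotent_basis gU NN (row_base_free _) BT.
have [P ZP] := Zcl (\rank (trig_sp g)).
have [free1 T1] := Ms 1; rewrite expr1n !scale1r in free1 T1.
have [V [ZV MV]] : exists V, Z V /\ ((M0 + M1 + M2)%R == V)%MS.
  have [_ ZP1] := ZP _ free1; apply: ZP1 => p Pp.
  have := @meval_eq0_limit _ p (fun t => mxvec M0 0 t)
    (fun t => mxvec M1 0 t) (fun t => mxvec M2 0 t).
  rewrite (_ : p.@[_] = p.@[fun t => mxvec (M0 + M1 + M2) 0 t]); last first.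
    by apply: meval_eq => t; rewrite !linearD !mxE.
  apply=> s s1; have [frees Ts] := Ms s.
  have [/(_ _) H _] := ZP _ frees.
  rewrite -[RHS](H _ p Pp).
    by apply: meval_eq => t; rewrite !linearD !linearZ !mxE.
  exists (trig_sp (g *m (1%:M - s *: N))); split=> //.
  suff /Sb0/SZ[] : K_orbit b0 (trig_sp (g *m (1%:M - s *: N))) by [].
  exact: K_orbit_trans (K_orbit_eqmx b0g) (gK s s1).
(* Closedness is relative to the Borel subalgebras: the limit lies in [S], and not only in [Z],
   because it is again a flag stabilizer. *)
have VT : (V == trig_sp (g *m (1%:M - 1 *: N)))%MS.
  by rewrite scale1r; apply: eqsp_trans (eqsp_sym MV) T1.
have b0V : K_orbit b0 V.
  apply/Sb0/SZ; split=> //; apply: Borel_eqmx (eqsp_sym VT) _.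
  by apply: Borel_trig_sp; case: gfr.
have TV := K_orbit_eqmx VT.
move=> W; apply: iff_trans (Sb0 W) (iff_trans _ (iff_sym (split_orbitE W gfr))).
split=> [b0W|TW].
  exact: K_orbit_trans (K_orbit_sym TV) (K_orbit_trans (K_orbit_sym b0V) b0W).
exact: K_orbit_trans b0V (K_orbit_trans TV TW).
Qed.

End ClosedOrbits.

(** * Determinantal equations for the split orbits *)

Section RankConditions.
Variables (C : numClosedFieldType).

(** Minors are indexed by arbitrary maps, repetitions included, which spares injectivity conditions.
    If the rank exceeds [r], maximal free rows and then columns give an invertible minor of size
    [\rank A]. *)
Lemma rank_leq_minors (d p r : nat) (A : 'M[C]_(d, p)) :
  (\rank A <= r)%N <->
  forall s (f : 'I_s -> 'I_d) (h : 'I_s -> 'I_p), (r < s)%N ->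
    \det (mxsub f h A) = 0.
Proof.
split=> [rA s f h lt_rs|det0].
  apply/eqP; apply: contraTT lt_rs; rewrite -unitfE -unitmxE -leqNgt => U.
  suff: (\rank (mxsub f h A) <= \rank A)%N.
    by rewrite mxrank_unit // => /leq_trans; apply.
  have -> : mxsub f h A = rowsub f 1%:M *m A *m colsub h 1%:M.
    by rewrite mulmx_colsub mulmx1 mul_rowsub_mx mul1mx; apply/matrixP => a b; rewrite !mxE.
  exact: leq_trans (mxrankM_maxl _ _) (mxrankM_maxr _ _).
rewrite leqNgt; apply/negP => lt_rA.
pose f := maxrankfun A.
have freeR : row_free (rowsub f A) := maxrowsub_free A.
have fullT : row_full (rowsub f A)^T by rewrite /row_full mxrank_tr.
have := fullrowsub_unit fullT.
have /eqP := det0 _ f (fullrankfun fullT) lt_rA.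
rewrite -det_tr => /eqP d0.
rewrite unitmxE (_ : rowsub _ _ = (mxsub f (fullrankfun fullT) A)^T) ?d0 ?unitr0 //.
by apply/matrixP => a b; rewrite !mxE.
Qed.

Lemma zclosed_rank_leq (N p r : nat) (L : 'M[C]_(N, p)) :
  zclosed_gr (fun V : 'M[C]_N => (\rank (V *m L) <= r)%N).
Proof.
move=> d.
pose minor s (f : 'I_s -> 'I_d) (h : 'I_s -> 'I_p) : {mpoly C[d * N]} :=
  \det (\matrix_(a, b) \sum_k 'X_(mxvec_index (f a) k) * (L k (h b))%:MP).
exists (fun P => exists s f h, (r < s)%N /\ P = @minor s f h) => M _.
have minorE s f h : (@minor s f h).@[fun k => mxvec M 0 k] = \det (mxsub f h (M *m L)).
  rewrite /minor -[LHS]/(meval _ _) -det_map_mx; congr (\det _).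
  apply/matrixP => a b; rewrite !mxE rmorph_sum; apply: eq_bigr => k _.
  by rewrite rmorphM /= mevalXU mevalC mxvecE.
split=> [[V [rV MV]] P [s [f [h [lt_rs ->]]]]|P0].
  rewrite minorE; apply/rank_leq_minors: s f h lt_rs.
  by rewrite (eqmxMr _ (eqmxP MV)).
exists <<M>>%MS; split; last by apply/eqmxP/eqmx_sym/genmxE.
rewrite (eqmxMr _ (genmxE M)); apply/rank_leq_minors => s f h lt_rs.
by rewrite -minorE; apply: P0; exists s, f, h.
Qed.

(** The two families of equations may produce different matrices with the same row space; invariance
    of [Z1] moves its condition to the representative found for [Z2]. *)
Lemma zclosed_grI (N : nat) (Z1 Z2 : 'M[C]_N -> Prop) :
    (forall V W, (V == W)%MS -> Z1 V -> Z1 W) ->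
    zclosed_gr Z1 -> zclosed_gr Z2 -> zclosed_gr (fun V => Z1 V /\ Z2 V).
Proof.
move=> Z1eq cl1 cl2 d; have [P1 H1] := cl1 d; have [P2 H2] := cl2 d.
exists (fun p => P1 p \/ P2 p) => M Mfree.
have [H1a H1b] := H1 M Mfree; have [H2a H2b] := H2 M Mfree.
split=> [[V [[Z1V Z2V] MV]] p []|P0].
- by apply: H1a; exists V.
- by apply: H2a; exists V.
have [V1 [Z1V MV1]] : exists V, Z1 V /\ (M == V)%MS.
  by apply: H1b => p Pp; apply: P0; left.
have [V2 [Z2V MV2]] : exists V, Z2 V /\ (M == V)%MS.
  by apply: H2b => p Pp; apply: P0; right.
exists V2; split=> //; split=> //; apply: Z1eq Z1V.
exact: eqsp_trans (eqsp_sym MV1) MV2.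
Qed.

Variable m : nat.
Implicit Types (g : 'M[C]_m.+1) (V : 'M[C]_(m.+1 * m.+1)) (j q : 'I_m.+1).

Local Notation er j := (delta_mx (0 : 'I_1) j : 'rV[C]_m.+1).
Local Notation ec j := (delta_mx j (0 : 'I_1) : 'cV[C]_m.+1).

Definition last_row_mx : 'M[C]_(m.+1 * m.+1, m.+1) :=
  lin1_mx (fun v => er ord_max *m vec_mx v).

Definition last_col_mx : 'M[C]_(m.+1 * m.+1, m.+1) :=
  lin1_mx (fun v => (vec_mx v *m ec ord_max)^T).

Lemma last_row_mxE A : mxvec A *m last_row_mx = er ord_max *m A.
Proof.
have fL : linear (fun v : 'rV[C]_(m.+1 * m.+1) => er ord_max *m vec_mx v).
  by move=> c u v; rewrite !linearP.
by rewrite (lin1_mxE fL) mxvecK.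
Qed.

Lemma last_col_mxE A : mxvec A *m last_col_mx = (A *m ec ord_max)^T.
Proof.
have fL : linear (fun v : 'rV[C]_(m.+1 * m.+1) => (vec_mx v *m ec ord_max)^T).
  by move=> c u v; rewrite linearP mulmxDl -scalemxAl linearP.
by rewrite (lin1_mxE fL) mxvecK.
Qed.

(** For a split flag at position [j], [V] moves the last basis row vector within the flag member of
    dimension [j + 1], and the last basis column vector within the annihilator of the member of
    dimension [j]. *)
Definition last_rank_bound j V :=
  (\rank (V *m last_row_mx) <= j.+1)%N /\
  (\rank (V *m last_col_mx) <= m.+1 - j)%N.

Lemma zclosed_last_rank_bound j : zclosed_gr (last_rank_bound j).
Proof.
apply: zclosed_grI; try exact: zclosed_rank_leq.
by move=> V W /eqmxP VW; rewrite (eqmxMr _ VW).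
Qed.

Lemma mulmx_sub_in_sp V p (L : 'M[C]_(m.+1 * m.+1, p)) (W : 'M[C]_p) :
  (forall A, in_sp A V -> (mxvec A *m L <= W)%MS) -> (V *m L <= W)%MS.
Proof.
move=> VW; apply/row_subP => r; rewrite row_mul -[row r V]vec_mxK.
by apply: VW; apply: in_sp_row.
Qed.

Lemma split_orbit_rank_bound j V : split_orbit j V -> last_rank_bound j V.
Proof.
move=> [g [gU gr gc] /eqmxP VT]; rewrite /last_rank_bound !(eqmxMr _ VT).
have er_max : er ord_max *m invmx g = er j by rewrite -gr mulmxK.
have AE A : A = invmx g *m (g *m A *m invmx g) *m g.
  by rewrite !mulmxA mulVmx // mul1mx mulmxKV.
split.
  apply: (@leq_trans (\rank ((pid_mx j.+1 : 'M[C]_m.+1) *m g))).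
    apply: mxrankS; apply: mulmx_sub_in_sp => A /in_trig_sp; rewrite last_row_mxE.
    rewrite {2}[A]AE; move: (g *m A *m invmx g) => T /is_trig_mxP T0.
    rewrite !mulmxA er_max submxMr //; apply/submxP; exists (er j *m T).
    apply/rowP => b; rewrite -rowE [RHS]mxE (bigD1 b) //= big1 => [|a ab].
      rewrite !mxE eqxx /= addr0; case: ltnP; rewrite ?mulr1 // => ltjb.
      by rewrite T0 // mul0r.
    by rewrite !mxE (negPf (_ : a != b :> nat)) ?mulr0.
  by apply: leq_trans (mxrankM_maxl _ _) _; rewrite rank_pid_mx.
apply: (@leq_trans (\rank ((copid_mx j : 'M[C]_m.+1) *m (invmx g)^T))).
  apply: mxrankS; apply: mulmx_sub_in_sp => A /in_trig_sp; rewrite last_col_mxE.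
  rewrite {2}[A]AE; move: (g *m A *m invmx g) => T /is_trig_mxP T0.
  rewrite -!mulmxA gc trmx_mul submxMr //; apply/submxP; exists (T *m ec j)^T.
  apply/rowP => b; rewrite mulmxBr mulmx1 [RHS]mxE [X in _ + X]mxE -[LHS]subr0.
  congr (_ - _); apply/esym; rewrite -colE mxE (bigD1 b) //= big1 => [|a ab].
    rewrite !mxE eqxx /= addr0; case: ltnP => ltbj; rewrite ?mulr0 //.
    by rewrite T0 // mul0r.
  by rewrite !mxE (negPf (_ : a != b :> nat)) ?mulr0.
apply: leq_trans (mxrankM_maxl _ _) _; rewrite rank_copid_mx //.
exact: ltnW.
Qed.

(** The row bound confines the support of [x = er ord_max *m invmx g] to indices at most [j]. As [x]
    has entry 1 at [q], this gives [q <= j], and the column bound gives [j <= q]. *)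
Lemma rank_bound_position j q g V : g \in unitmx -> (V == trig_sp g)%MS ->
    g *m ec ord_max = ec q -> last_rank_bound j V ->
  q = j /\ forall c : 'I_m.+1, (j < c)%N -> (er ord_max *m invmx g) 0 c = 0.
Proof.
move=> gU /eqmxP VT gc; rewrite /last_rank_bound !(eqmxMr _ VT) => -[rrow rcol].
have [x xE] : exists x, x = er ord_max *m invmx g by eexists.
have inT (a b : 'I_m.+1) : (b <= a)%N -> in_sp (invmx g *m (ec a *m er b) *m g) (trig_sp g).
  move=> le_ba; apply/in_trig_sp; rewrite !mulmxA mulmxV // mul1mx mulmxK //.
  exact: is_trig_delta.
(* If [x] is nonzero at [c], the conjugated elementary matrices with row [c] and column [b <= c]
   send the last basis vector to nonzero multiples of rows [0..c] of [g], so the rank is at least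
   [c + 1]. *)
have xpos (c : 'I_m.+1) : x 0 c != 0 -> (c <= j)%N.
  move=> xc; rewrite -ltnS; apply: leq_trans rrow.
  have <- : \rank (pid_mx c.+1 *m g : 'M[C]_m.+1) = c.+1.
    by rewrite mxrankMfree ?row_free_unit // rank_pid_mx.
  apply: mxrankS; apply/row_subP => b; rewrite row_mul.
  have [lt_bc|le_cb] := ltnP b c.+1; last first.
    rewrite (_ : row b _ = 0) ?mul0mx ?sub0mx //.
    by apply/rowP => a; rewrite !mxE ltnNge le_cb andbF.
  rewrite (_ : row b _ = er b); last first.
    by apply/rowP => a; rewrite !mxE lt_bc andbT eqxx /= eq_sym.
  have := submxMr last_row_mx (inT c b lt_bc); rewrite last_row_mxE !mulmxA -xE.
  rewrite -[x *m ec c]mulmx1 -colE [col c x]mx11_scalar mxE mulmx1.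
  by rewrite mul_scalar_mx -scalemxAl (eqmx_scale _ xc).
have jq : (j <= q)%N.
  suff: (m.+1 - q <= m.+1 - j)%N by move: (ltn_ord q) (ltn_ord j); lia.
  apply: leq_trans rcol.
  have <- : \rank (copid_mx q *m (invmx g)^T : 'M[C]_m.+1) = (m.+1 - q)%N.
    rewrite mxrankMfree ?rank_copid_mx ?row_free_unit ?unitmx_tr ?unitmx_inv //.
    exact: ltnW.
  apply: mxrankS; apply/row_subP => b; rewrite row_mul.
  have [lt_bq|le_qb] := ltnP b q.
    rewrite (_ : row b _ = 0) ?mul0mx ?sub0mx //.
    by apply/rowP => a; rewrite !mxE lt_bq andbT subrr.
  rewrite (_ : row b _ = er b); last first.
    apply/rowP => a; rewrite !mxE ltnNge le_qb andbF subr0 eqxx /=.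
    by rewrite eq_sym.
  have := submxMr last_col_mx (inT b q le_qb); rewrite last_col_mxE.
  rewrite -!mulmxA gc er_ec mulmx1 trmx_mul.
  by rewrite trmx_delta.
have xq : x *m ec q = 1%:M by rewrite -gc xE mulmxA mulmxKV // er_ec.
have qj : (q <= j)%N.
  apply: xpos; move/matrixP/(_ 0 0): xq; rewrite -colE !mxE eqxx => ->.
  exact: oner_neq0.
split; first by apply: val_inj; apply/eqP; rewrite eqn_leq qj.
move=> c ltjc; rewrite -xE; apply/eqP; apply: contraTT ltjc => /xpos.
by rewrite -leqNgt.
Qed.

Lemma split_orbit_inj j j' V : split_orbit j V -> split_orbit j' V -> j = j'.
Proof.
move=> jV [g [gU _ gc] VT].
by have [->] := rank_bound_position gU VT gc (split_orbit_rank_bound jV).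
Qed.

Lemma split_orbit_eqmx j V W : (V == W)%MS -> split_orbit j V -> split_orbit j W.
Proof.
by move=> VW [g gF VT]; exists g => //; apply: eqsp_trans (eqsp_sym VW) VT.
Qed.

Lemma split_orbitP j V : split_orbit j V <-> Borel V /\ last_rank_bound j V.
Proof.
split=> [jV|[/BorelP[g gU VT] bV]].
  split; last exact: split_orbit_rank_bound.
  by case: jV => g [gU _ _] VT; apply/BorelP; exists g.
have [q [h [hU hT hc]]] := normalize_last_col gU.
have Vh : (V == trig_sp h)%MS := eqsp_trans VT (eqsp_sym hT).
have [qj x0] := rank_bound_position hU Vh hc bV.
apply: split_orbit_eqmx (eqsp_sym Vh) _; apply: normalize_last_row => //.
by rewrite hc qj.
Qed.

Lemma closed_K_orbit_split_orbit j : closed_K_orbit (@split_orbit C m j).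
Proof.
split; last first.
  exists (last_rank_bound j); split; first exact: zclosed_last_rank_bound.
  exact: split_orbitP.
pose g : 'M[C]_m.+1 := perm_mx (tperm j ord_max).
have gF : frame j g.
  split; first exact: unitmx_perm.
    by apply/rowP => a; rewrite -rowE !mxE tpermL eqxx /= eq_sym.
  apply/colP => a; rewrite -colE !mxE eqxx andbT; congr (_%:R).
  by rewrite -(inj_eq (@perm_inj _ (tperm j ord_max))) tpermK tpermR.
exists (trig_sp g); split; first by apply: Borel_trig_sp; case: gF.
by move=> V; apply: split_orbitE.
Qed.

End RankConditions.

(** * Borel subalgebras containing the diagonal matrices, and total orders *)

Section CoordinateFlags.
Variable C : numClosedFieldType.

(* [V] is the Borel subalgebra of the coordinate flag listing the basis vectors
   by increasing [r]. *)
Definition adapted (m : nat) (r : nat -> nat) (V : 'M[C]_(m * m)) :=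
  forall A, in_sp A V <-> forall a b : 'I_m, (r a < r b)%N -> A a b = 0.

(** Orders are given by functions on [nat], so that a single [r] describes every corner at once. *)
Definition inj_below (m : nat) (r : nat -> nat) :=
  forall a b, (a < m)%N -> (b < m)%N -> r a = r b -> a = b.

Lemma adapted_unique m r (V W : 'M[C]_(m * m)) :
  adapted r V -> adapted r W -> (V == W)%MS.
Proof.
move=> rV rW; apply: in_sp_eqP => A.
exact: iff_trans (rV A) (iff_sym (rW A)).
Qed.

Lemma adapted_eqmx m r (V W : 'M[C]_(m * m)) :
  (V == W)%MS -> adapted r V -> adapted r W.
Proof.
move=> VW rV A; apply: iff_trans (rV A); apply: iff_sym; exact: in_sp_eqmx.
Qed.

Lemma adapted_ext m r r' (V : 'M[C]_(m * m)) :
    (forall a b, (a < m)%N -> (b < m)%N -> (r a < r b)%N = (r' a < r' b)%N) ->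
  adapted r V -> adapted r' V.
Proof.
move=> rr' rV A; apply: iff_trans (rV A) _; split=> A0 a b ltab; apply: A0.
  by rewrite rr'.
by rewrite -rr'.
Qed.

Lemma invmx_perm_mx m (p : 'S_m) : invmx (perm_mx p) = perm_mx p^-1%g :> 'M[C]_m.
Proof.
apply: (can_inj (mulKmx (unitmx_perm C p))).
by rewrite mulmxV ?unitmx_perm // -perm_mxM mulgV perm_mx1.
Qed.

Lemma adapted_trig_sp m (r : nat -> nat) (p : 'S_m) :
    (forall a b : 'I_m, (r a < r b)%N = (p a < p b)%N) ->
  adapted r (trig_sp (perm_mx p^-1%g : 'M[C]_m)).
Proof.
move=> rp A; have AE a b :
    (perm_mx p^-1%g *m A *m invmx (perm_mx p^-1%g)) a b = A (p^-1 a)%g (p^-1 b)%g.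
  by rewrite invmx_perm_mx -col_permE -row_permE !mxE.
apply: iff_trans (in_trig_sp _ A) _; split=> [/is_trig_mxP A0 a b|A0].
  by rewrite rp => /A0; rewrite AE !permK.
by apply/is_trig_mxP => a b ltab; rewrite AE A0 // rp !permKV.
Qed.

(** Replaces [r] by the permutation counting smaller values. The count is recorded because at the
    last index it is the position of the split orbit. *)
Lemma rank_perm m r : inj_below m r ->
  exists p : 'S_m, (forall a b : 'I_m, (r a < r b)%N = (p a < p b)%N) /\
    forall a, p a = #|[set c : 'I_m | r c < r a]%N| :> nat.
Proof.
move=> rinj; pose S (a : 'I_m) := [set c : 'I_m | r c < r a]%N.
have ltS a : (#|S a| < m)%N.
  rewrite -[X in (_ < X)%N]card_ord -cardsT; apply: proper_card.
  by apply/properP; split; [apply: subsetT | exists a; rewrite !inE // ltnn].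
have monoS (a b : 'I_m) : (r a < r b)%N -> (#|S a| < #|S b|)%N.
  move=> ltab; apply: proper_card; apply/properP; split.
    by apply/subsetP => c; rewrite !inE => /ltn_trans; apply.
  by exists a; rewrite !inE // ltnn.
have SE (a b : 'I_m) : (r a < r b)%N = (#|S a| < #|S b|)%N.
  have [/monoS->//|/monoS ltba|eab] := ltngtP (r a) (r b).
    by rewrite ltnNge (ltnW ltba).
  by rewrite (_ : a = b) ?ltnn //; apply: val_inj; apply: (rinj a b).
pose f a := Ordinal (ltS a).
have finj : injective f.
  move=> a b /(congr1 val) /= eab; apply: val_inj; apply: (rinj a b) => //.
  by have := SE a b; have := SE b a; rewrite eab ltnn; case: ltngtP.
by exists (perm finj); split=> [a b|a]; rewrite !permE //= SE.
Qed.

Lemma adapted_Borel m r (V : 'M[C]_(m * m)) :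
  inj_below m r -> adapted r V -> Borel V.
Proof.
move=> /rank_perm[p [rp _]] rV; apply/BorelP.
exists (perm_mx p^-1%g); first exact: unitmx_perm.
exact: adapted_unique rV (adapted_trig_sp rp).
Qed.

Lemma adapted_exists m r : inj_below m r -> exists V : 'M[C]_(m * m), adapted r V.
Proof. by move=> /rank_perm[p [rp _]]; eexists; apply: adapted_trig_sp rp. Qed.

Lemma adapted_split_orbit m (r : nat -> nat) (V : 'M[C]_(m.+1 * m.+1)) (p : 'S_m.+1) :
    (forall a b : 'I_m.+1, (r a < r b)%N = (p a < p b)%N) -> adapted r V ->
  split_orbit (p ord_max) V.
Proof.
move=> rp rV; exists (perm_mx p^-1%g); last exact: adapted_unique rV (adapted_trig_sp rp).
split; first exact: unitmx_perm.
  by apply/rowP => a; rewrite -rowE !mxE permK eqxx /= eq_sym.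
apply/colP => a; rewrite -colE !mxE eqxx andbT; congr (_%:R).
by rewrite -(inj_eq (@perm_inj _ p)) permKV.
Qed.

(** Conjugating each [E_aa] into triangular form gives [g p a * invmx g a q = 0] for [p < q].
    Picking in each row [p] a column [s p] with nonzero product on the diagonal yields a
    permutation, and [g] is that permutation matrix up to a lower triangular factor. *)
Lemma Borel_diag_adapted m (V : 'M[C]_(m * m)) :
  Borel V -> contains_diag V -> exists2 r, inj_below m r & adapted r V.
Proof.
move=> /BorelP[g gU VT] Vdiag.
have gE0 a (p q : 'I_m) : (p < q)%N -> g p a * invmx g a q = 0.
  move=> ltpq; have /Vdiag/(in_sp_eqmx _ VT)/in_trig_sp/is_trig_mxP/(_ p q ltpq) :
      is_diag_mx (delta_mx a a : 'M[C]_m).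
    apply/is_diag_mxP => b c neq; rewrite mxE; case: eqP => //= ba.
    by case: eqP => // ca; rewrite ba ca eqxx in neq.
  rewrite -(mul_delta_mx (0 : 'I_1)) mulmxA -mulmxA -colE -rowE mxE big_ord1.
  by rewrite !mxE.
have ex_a (p : 'I_m) : exists a, g p a * invmx g a p != 0.
  apply/existsP; apply: contraT; rewrite negb_exists => /forallP H.
  have /matrixP/(_ p p)/eqP := mulmxV gU.
  rewrite !mxE big1 ?eqxx 1?eq_sym ?oner_eq0 // => a _.
  by apply/eqP; rewrite -[_ == _]negbK H.
have [s sP] := fin_all_exists ex_a.
have sn0 p : g p (s p) != 0 /\ invmx g (s p) p != 0.
  by move: (sP p); rewrite mulf_eq0 negb_or => /andP.
have sinj : injective s.
  have no p q : s p = s q -> ~~ (p < q)%N.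
    move=> e; apply/negP => /(gE0 (s p))/eqP; rewrite mulf_eq0.
    by rewrite (negPf (sn0 p).1) e (negPf (sn0 q).2).
  move=> p q e; apply: val_inj => /=; case: (ltngtP p q) => // [ltpq|ltqp].
    by have := no p q e; rewrite ltpq.
  by have := no q p (esym e); rewrite ltqp.
pose S := perm sinj.
pose T := g *m perm_mx S^-1%g; pose T' := perm_mx S *m invmx g.
have TT' : T *m T' = 1%:M.
  rewrite /T /T' mulmxA -(mulmxA g) -perm_mxM mulVg perm_mx1 mulmx1.
  exact: mulmxV.
have Ttrig : is_trig_mx T.
  apply/is_trig_mxP => q p /(gE0 (s p))/eqP; rewrite /T -col_permE mxE permE.
  by rewrite mulf_eq0 (negPf (sn0 p).2) orbF => /eqP.
have T'trig : is_trig_mx T'.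
  apply/is_trig_mxP => p q /(gE0 (s p))/eqP; rewrite /T' -row_permE mxE permE.
  by rewrite mulf_eq0 (negPf (sn0 p).1) => /eqP.
have [_] := trig_sp_mulT (unitmx_perm C S) TT' Ttrig T'trig.
rewrite /T -mulmxA -perm_mxM mulVg perm_mx1 mulmx1 => gS.
(* The value 0 beyond [m] is a filler: injectivity and [adapted] look only at indices below [m]. *)
pose r k := if insub k is Some a then val ((S^-1)%g a) else 0%N.
have rE (a : 'I_m) : r a = (S^-1)%g a by rewrite /r valK.
exists r.
  move=> a b lta ltb; rewrite (rE (Ordinal lta)) (rE (Ordinal ltb)).
  by move/val_inj/perm_inj/(congr1 val).
apply: adapted_eqmx (eqsp_sym (eqsp_trans VT gS)) _; rewrite -[S]invgK.
by apply: adapted_trig_sp => a b; rewrite !rE.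
Qed.

Lemma in_proj_sp (n i : nat) (b : 'M[C]_(n.+1 * n.+1)) (B : 'M[C]_i) :
  in_sp B (proj_sp i b) <-> exists2 A, in_sp A b & B = corner i A.
Proof. by apply: in_sp_mul_lin1 => c X Y; apply/matrixP => u v; rewrite !mxE. Qed.

(** Extension by zero, a section of [corner] when the corner fits; it lifts elements of a projection
    back to full size. *)
Definition pad (n i : nat) (B : 'M[C]_i) : 'M[C]_n.+1 :=
  \matrix_(a, b) if insub (val a) is Some a' then
                   if insub (val b) is Some b' then B a' b' else 0 else 0.

Lemma corner_pad n i (B : 'M[C]_i) : (i <= n.+1)%N -> corner i (pad n B) = B.
Proof.
move=> le_in; apply/matrixP => a b; rewrite !mxE /=.
by rewrite !inordK ?(leq_trans (ltn_ord _) le_in) // !valK.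
Qed.

Lemma pad_corner n i (A : 'M[C]_n.+1) (a b : 'I_n.+1) :
  pad n (corner i A) a b = if (a < i)%N && (b < i)%N then A a b else 0.
Proof.
rewrite mxE; case: insubP => [a' lta ea|/negPf-> //]; rewrite lta.
case: insubP => [b' ltb eb|/negPf-> //]; rewrite ltb mxE.
by rewrite ea eb !inord_val.
Qed.

Lemma adapted_proj n i r (b : 'M[C]_(n.+1 * n.+1)) :
  (i <= n.+1)%N -> adapted r b -> adapted r (proj_sp i b).
Proof.
move=> le_in rb B; split=> [/in_proj_sp[A /rb A0 ->] u v lt_uv|B0].
  by rewrite mxE A0 // !inordK ?(leq_trans (ltn_ord _) le_in).
apply/in_proj_sp; exists (pad n B); rewrite ?corner_pad //; apply/rb => u v.
rewrite mxE; case: insubP => // u' _ <-; case: insubP => // v' _ <-.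
exact: B0.
Qed.

Lemma split_orbit_delta m (j : 'I_m.+1) (V : 'M[C]_(m.+1 * m.+1)) :
  split_orbit j V -> in_sp (delta_mx ord_max ord_max) V.
Proof.
move=> [g [gU gr gc] VT]; apply/(in_sp_eqmx _ VT)/in_trig_sp.
rewrite -(mul_delta_mx (0 : 'I_1)) mulmxA gc -mulmxA -gr mulmxK //.
exact: is_trig_delta.
Qed.

Lemma lie_br_delta m (k : 'I_m) (X : 'M[C]_m) a b :
  lie_br (delta_mx k k) X a b = ((a == k)%:R - (b == k)%:R) * X a b.
Proof.
rewrite /lie_br -(mul_delta_mx (0 : 'I_1)) -mulmxA -rowE mulmxA -colE.
rewrite !mxE !big_ord1 !mxE !eqxx andbT /= mulrBl [X _ _ * _]mulrC.
by congr (_ - _); case: eqP => [->|]; rewrite ?mul0r.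
Qed.

(* The projections contain the elementary matrices [E_kk], which grade [b];
   the degree 0 parts show, corner after corner, that [E_kk] lies in [b]. *)
Lemma split_projections_diag n (b : 'M[C]_(n.+1 * n.+1)) : lie_sub b ->
    (forall m, (m < n.+1)%N -> exists j : 'I_m.+1, split_orbit j (proj_sp m.+1 b)) ->
  contains_diag b.
Proof.
move=> blie bsplit.
(* Downward induction on the corner size [i]: truncation to that corner preserves [b], and [b]
   contains the diagonal units outside it. *)
have key d i : (i + d = n.+1)%N ->
    (forall A, in_sp A b -> in_sp (pad n (corner i A)) b) /\
    (forall a : 'I_n.+1, (i <= a)%N -> in_sp (delta_mx a a) b).
  elim: d i => [|d IHd] i.
    rewrite addn0 => ->; split=> [A Ab|a]; last by rewrite leqNgt ltn_ord.
    suff -> : pad n (corner n.+1 A) = A by [].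
    by apply/matrixP => u v; rewrite pad_corner !ltn_ord.
  rewrite addnS -addSn => e; have [trunc diag] := IHd _ e.
  have ltin : (i < n.+1)%N by rewrite -e ltnS leq_addr.
  pose k := Ordinal ltin.
  have [j /split_orbit_delta/in_proj_sp[D Db DE]] := bsplit i ltin.
  (* The projection only provides some [D] in [b] whose corner is [E_kk]; truncating [D] yields
     [E_kk] itself. *)
  have Eb : in_sp (delta_mx k k) b.
    have := trunc _ Db; rewrite -DE (_ : pad n _ = delta_mx k k) //.
    apply/matrixP => u v; rewrite !mxE.
    case: insubP => [u' _ eu|ltu]; last first.
      by rewrite -val_eqE /= gtn_eqF // ltnNge -ltnS.
    case: insubP => [v' _ ev|ltv]; last first.
      by rewrite -!val_eqE /= [v == i :> nat]gtn_eqF ?andbF // ltnNge -ltnS.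
    by rewrite mxE -!val_eqE /= eu ev.
  split=> [A /trunc Ab|a]; last first.
    rewrite leq_eqVlt => /predU1P[ia|]; last exact: diag.
    by rewrite (_ : a = k) //; apply: val_inj.
  set X := pad n _ in Ab.
  (* Bracketing with [E_kk] has eigenvalues 0, 1 and -1, so its square projects onto the entries of
     row and column [k] off the diagonal. Removing these and the entry at [(k, k)] shrinks the
     corner by one. *)
  have -> : pad n (corner i A) =
      X - lie_br (delta_mx k k) (lie_br (delta_mx k k) X) - X k k *: delta_mx k k.
    have entry (P Q R : 'M[C]_n.+1) c u v :
        (P - Q - c *: R) u v = P u v - Q u v - c * R u v by rewrite !mxE.
    apply/matrixP => u v; rewrite entry !lie_br_delta [delta_mx _ _ _ _]mxE.
    rewrite !pad_corner -!val_eqE /= !ltnS.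
    have [ui|ui] := eqVneq (u : nat) i; have [vi|vi] := eqVneq (v : nat) i.
    - have -> : u = k by apply: val_inj.
      have -> : v = k by apply: val_inj.
      by rewrite /= ltnn leqnn /=; ring.
    - by rewrite ui ltnn leqnn /=; ring.
    - by rewrite vi ltnn leqnn andbF /=; ring.
    rewrite !subrr !mul0r mulr0 !subr0.
    by rewrite [(u < i)%N]ltn_neqAle [(v < i)%N]ltn_neqAle ui vi.
  apply: in_spB; last exact: in_spZ.
  by apply: in_spB => //; apply: (blie) => //; apply: blie.
have [_ diag] := key n.+1 0 (add0n _).
move=> A /is_diag_mxP A0.
have -> : A = \sum_a A a a *: delta_mx a a.
  apply/matrixP => u v; rewrite summxE (bigD1 u) //= big1 => [|a au].
    rewrite !mxE eqxx addr0 /=; have [->|uv] := eqVneq v u; first by rewrite mulr1.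
    by rewrite mulr0 A0 // eq_sym.
  by rewrite !mxE [u == a]eq_sym (negPf au) mulr0.
by apply: in_sp_sum => a; apply: in_spZ; apply: diag.
Qed.

(** Induction on [n]: once the order of the earlier indices is known, the number of them below a new
    index decides on which side of each it falls. *)
Lemma rank_determines_order n r r' : inj_below n r -> inj_below n r' ->
    (forall m, (m < n)%N -> #|[set c : 'I_m.+1 | r c < r m]%N| =
                            #|[set c : 'I_m.+1 | r' c < r' m]%N|) ->
  forall a b, (a < n)%N -> (b < n)%N -> (r a < r b)%N = (r' a < r' b)%N.
Proof.
move=> rinj rinj' rank_eq.
pose cnt (f : nat -> nat) m a := (\sum_(c < m) (f c < f a))%N.
have cntE (f : nat -> nat) m : #|[set c : 'I_m.+1 | f c < f m]%N| = cnt f m m.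
  rewrite -sum1dep_card big_mkcond /= big_ord_recr /= ltnn addn0.
  by apply: eq_bigr => c _; case: (_ < _)%N.
(* If [f a < f m], the index [a] is counted below [m] but not below itself, so the count is strictly
   larger. On the right, the first count uses only earlier indices and the second is the given
   position. *)
have lt_cnt (f : nat -> nat) m a : (a < m)%N -> (f a < f m)%N = (cnt f m a < cnt f m m)%N.
  move=> ltam; have [ltf|lef] := ltnP (f a) (f m); apply/esym; last first.
    apply/negbTE; rewrite -leqNgt; apply: leq_sum => c _.
    by case: ltnP => // /leq_trans/(_ lef) ->.
  rewrite /cnt (bigD1 (Ordinal ltam)) //= [X in (_ < X)%N](bigD1 (Ordinal ltam)) //=.
  rewrite ltnn ltf add0n add1n ltnS; apply: leq_sum => c _.
  by case: ltnP => // /ltn_trans/(_ ltf) ->.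
have main m : (m <= n)%N ->
    forall a b, (a < m)%N -> (b < m)%N -> (r a < r b)%N = (r' a < r' b)%N.
  elim: m => // m IHm ltmn; have {}IHm := IHm (ltnW ltmn).
  have last a : (a < m)%N -> (r a < r m)%N = (r' a < r' m)%N.
    move=> ltam; rewrite (lt_cnt r) // (lt_cnt r') // -!cntE rank_eq //.
    congr (_ < _)%N; apply: eq_bigr => c _.
    by rewrite IHm.
  have flip (f : nat -> nat) a : inj_below n f -> (a < m)%N ->
      (f m < f a)%N = ~~ (f a < f m)%N.
    move=> finj ltam; rewrite -leqNgt ltn_neqAle; case: eqVneq => //= e.
    have := finj _ _ ltmn (ltn_trans ltam ltmn) e.
    by move=> ema; rewrite ema ltnn in ltam.
  move=> a b; rewrite !ltnS leq_eqVlt => /predU1P[->|ltam].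
    rewrite leq_eqVlt => /predU1P[->|ltbm]; first by rewrite !ltnn.
    by rewrite !flip // last.
  by rewrite leq_eqVlt => /predU1P[->|ltbm]; [apply: last | apply: IHm].
by move=> a b; apply: (main n).
Qed.

End CoordinateFlags.

(** * From sequences of orbits to total orders *)

Section Assembly.
Variable C : numClosedFieldType.

Lemma closed_orbits_adapted (m : nat) (Q : forall i : nat, 'M[C]_(i * i) -> Prop) :
    (forall i, (1 <= i <= m)%N -> closed_K_orbit (Q i)) ->
  exists r, [/\ inj_below m r, forall a, (a < m)%N -> (r a < m)%N &
    forall i, (1 <= i <= m)%N -> forall V : 'M[C]_(i * i), adapted r V -> Q i V].
Proof.
elim: m => [|m IHm] Qcl.
  by exists id; split=> // i /andP[i1 i0]; rewrite leqNgt i1 in i0.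
have [|r [rinj rlt rQ]] := IHm.
  by move=> i /andP[i1 im]; apply: Qcl; rewrite i1 leqW.
have [|j QE] := @closed_K_orbit_split C m (Q m.+1).
  by apply: Qcl; rewrite leqnn.
(* Insertion of the new index at position [j]: [bump j] raises the old values from [j] on by one and
   leaves [j] free. *)
pose r' a := if (a < m)%N then bump j (r a) else val j.
have rm' : r' m = j by rewrite /r' ltnn.
have rE a : (a < m)%N -> r' a = bump j (r a) by rewrite /r' => ->.
have rlt' a : (a < m.+1)%N -> (r' a < m.+1)%N.
  rewrite ltnS leq_eqVlt => /predU1P[->|ltam]; first by rewrite rm'.
  rewrite rE // /bump; have := rlt a ltam.
  by case: (j <= r a)%N; rewrite ?add1n ?add0n ltnS // => /ltnW.
have rinj' : inj_below m.+1 r'.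
  move=> a b; rewrite !ltnS leq_eqVlt => /predU1P[->|ltam].
    rewrite leq_eqVlt => /predU1P[->//|ltbm]; rewrite rm' rE // => e.
    by have := neq_bump j (r b); rewrite -e eqxx.
  rewrite leq_eqVlt => /predU1P[->|ltbm].
    rewrite rm' rE // => e.
    by have := neq_bump j (r a); rewrite e eqxx.
  by rewrite !rE // => /(can_inj (bumpK j)); apply: rinj.
have r'r a b : (a < m)%N -> (b < m)%N -> (r' a < r' b)%N = (r a < r b)%N.
  by move=> ltam ltbm; rewrite !rE // !ltnNge leq_bump2.
exists r'; split=> // i /andP[i1]; rewrite leq_eqVlt => /predU1P[->|ltim] V rV.
  pose f (a : 'I_m.+1) := Ordinal (rlt' a (ltn_ord a)).
  have finj : injective f.
    move=> a b /(congr1 val) /= e; apply: val_inj.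
    by apply: (rinj' a b) => //.
  have e : perm finj ord_max = j by apply: val_inj; rewrite permE /= rm'.
  apply/QE; rewrite -e; apply: (adapted_split_orbit _ rV) => a b.
  by rewrite !permE.
apply: rQ; first by rewrite i1.
by apply: adapted_ext rV => a b lta ltb; rewrite r'r ?(leq_trans lta) ?(leq_trans ltb).
Qed.

Lemma inj_belowS (m n : nat) r : (m <= n)%N -> inj_below n r -> inj_below m r.
Proof. by move=> le_mn rinj a b /leq_trans am /leq_trans bm; apply: rinj; auto. Qed.

Lemma split_orbits_order (m : nat) (j : 'I_m.+1) r (V : 'M[C]_(m.+1 * m.+1)) :
    inj_below m.+1 r -> adapted r V -> split_orbit j V ->
  #|[set c : 'I_m.+1 | r c < r m]%N| = j.
Proof.
move=> /rank_perm[p [rp pE]] rV jV; rewrite -[r m]/(r (ord_max : 'I_m.+1)) -pE.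
by congr val; apply: split_orbit_inj (adapted_split_orbit rp rV) jV.
Qed.

End Assembly.

Theorem theorem4p2 (C : numClosedFieldType) (n : nat) (hn : (1 <= n)%N) :
  (forall Q : forall i : nat, 'M[C]_(i * i) -> Prop,
     (forall i : nat, (1 <= i <= n.+1)%N -> closed_K_orbit (Q i)) ->
     exists b : 'M[C]_(n.+1 * n.+1),
       [/\ XQ Q b,
           (forall b' : 'M[C]_(n.+1 * n.+1), XQ Q b' -> (b' == b)%MS)
         & contains_diag b]) /\
  (forall b : 'M[C]_(n.+1 * n.+1), Borel b -> contains_diag b ->
     exists Q : forall i : nat, 'M[C]_(i * i) -> Prop,
       (forall i : nat, (1 <= i <= n.+1)%N -> closed_K_orbit (Q i)) /\ XQ Q b).
Proof.
split=> [Q Qcl|b bB bdiag].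
  have [r [rinj _ rQ]] := closed_orbits_adapted Qcl.
  have [b rb] := adapted_exists C rinj.
  have Qsplit m (ltmn : (m < n.+1)%N) : exists j : 'I_m.+1,
      forall V, Q m.+1 V <-> split_orbit j V by apply/closed_K_orbit_split/Qcl.
  have diagQ (b' : 'M[C]_(n.+1 * n.+1)) : XQ Q b' -> contains_diag b'.
    move=> [[b'lie _ _] Qb']; apply: split_projections_diag b'lie _ => m ltmn.
    have [j QE] := Qsplit m ltmn; exists j; apply/QE.
    by have [] := Qb' m.+1 ltmn.
  have XQb : XQ Q b.
    split=> [|i /andP[i1 iN]]; first exact: adapted_Borel rinj rb.
    have rbi := adapted_proj iN rb; split; last by apply: rQ rbi; rewrite i1.
    exact: adapted_Borel (inj_belowS iN rinj) rbi.
  exists b; split=> //; last exact: diagQ.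
  move=> b' XQb'; have [b'B Qb'] := XQb'.
  have [r' r'inj rb'] := Borel_diag_adapted b'B (diagQ _ XQb').
  apply: (adapted_unique (adapted_ext _ rb') rb) => a c lta ltc.
  apply: (rank_determines_order r'inj rinj) => // m ltmn.
  (* The corners of [b] and [b'] lie in the same split orbit, so in both orders the last index has
     the same number [j] of predecessors. *)
  have [j QE] := Qsplit m ltmn.
  rewrite (split_orbits_order (inj_belowS ltmn r'inj) (adapted_proj ltmn rb') (j := j)).
    rewrite (split_orbits_order (inj_belowS ltmn rinj) (adapted_proj ltmn rb) (j := j)) //.
    by apply/QE; have [_ /(_ m.+1 ltmn)[]] := XQb.
  by apply/QE; have [] := Qb' m.+1 ltmn.
have [r rinj rb] := Borel_diag_adapted bB bdiag.
have projB i : (i <= n.+1)%N -> Borel (proj_sp i b).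
  move=> iN; exact: adapted_Borel (inj_belowS iN rinj) (adapted_proj iN rb).
(* The sequence is forced: each orbit must contain the projection of [b]. It is closed because that
   projection is a coordinate flag stabilizer, hence split. *)
exists (fun i => K_orbit (proj_sp i b)); split=> [[|m] // ltmn|].
  have [p [rp _]] := rank_perm (inj_belowS ltmn rinj).
  have [g gF pT] := adapted_split_orbit rp (adapted_proj ltmn rb).
  have orbE V : K_orbit (proj_sp m.+1 b) V <-> split_orbit (p ord_max) V.
    apply: iff_trans _ (iff_sym (split_orbitE V gF)).
    split; apply: K_orbit_trans; apply: K_orbit_eqmx => //.
    exact: eqsp_sym.
  split; first by exists (proj_sp m.+1 b); split=> //; apply: projB.
  have [_ [Z [Zcl ZE]]] := closed_K_orbit_split_orbit C (p ord_max).
  by exists Z; split=> // V; apply: iff_trans (orbE V) (ZE V).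
split=> // i /andP[i1 iN]; split; first exact: projB.
by case: i i1 iN => // i _ _; apply: K_orbit_eqmx; rewrite !submx_refl.
Qed.
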